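(* Let $A$ be a unital $C^*$-algebra. (1) Assume that every $I\in\operatorname{Prim}(A)$ has a countable base for its system of neighborhoods. Then every strictly norming family $\mathcal F$ of representations of $A$ is also exhausting. (2) Assume that $\operatorname{Prim}(A)$ is a $T_1$ space. Then the converse is also true, that is, if every strictly norming family $\mathcal F$ of representations of $A$ is also exhausting, then every $I\in\operatorname{Prim}(A)$ has a countable base for its system of neighborhoods.
   Context: A representation of $A$ is a $*$-morphism $\phi:A\to\mathcal L(\mathcal H_\phi)$ into the bounded operators on a Hilbert space; families are sets of representations. $\operatorname{Prim}(A)$ is the set of primitive ideals (kernels of irreducible representations) of $A$ with the Jacobson topology, whose open sets are the sets $\operatorname{Prim}(J)=\{I\in\operatorname{Prim}(A): J\not\subset I\}$ for closed two-sided ideals $J\subset A$. A set $\mathcal F$ of representations of a unital $C^*$-algebra $A$ is strictly norming if for every $a\in A$ there is $\phi\in\mathcal F$ with $\|a\|=\|\phi(a)\|$. It is exhausting if for every irreducible representation $\pi$ of $A$ there is $\phi\in\mathcal F$ with $\ker(\phi)\subset\ker(\pi)$. *)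

(* Defs.v *)
From HB Require Import structures.
From mathcomp Require Import all_boot all_order all_algebra.
From mathcomp Require Import complex.
From mathcomp Require Import all_classical all_reals all_analysis.

Set Implicit Arguments.
Unset Strict Implicit.
Unset Printing Implicit Defensive.

Import Order.TTheory GRing.Theory Num.Theory.
Import numFieldNormedType.Exports.

Local Open Scope classical_set_scope.
Local Open Scope ring_scope.
Local Open Scope complex_scope.

(* The structures below are over an abstract [C : numClosedFieldType]; the
   theorem instantiates [C] with [R[i]], the complex numbers over [R : realType].
   The norm of a [normedModType C] takes its values in the nonnegative reals
   of [C]. *)

(* Unital C*-algebras.  The product is part of the mixin: Hierarchy Builder
   rejects a structure that inherits both from a ring and from a normed module,
   that join being already occupied by [numDomainType].  The zero algebra
   ([cone = 0]) is allowed. *)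
HB.mixin Record isCstarAlgebra (C : numClosedFieldType) A
    & CompleteNormedModule C A := {
  cmul : A -> A -> A;
  cone : A;
  star : A -> A;
  cmulA : associative cmul;
  cmul1a : left_id cone cmul;
  cmula1 : right_id cone cmul;
  cmul_linearl : forall b : A, linear (cmul ^~ b);
  cmul_linearr : forall a : A, linear (cmul a);
  starD : {morph star : a b / a + b};
  starZ : forall (c : C) (a : A), star (c *: a) = Num.conj c *: star a;
  starM : forall a b : A, star (cmul a b) = cmul (star b) (star a);
  starK : involutive star;
  norm_cmul : forall a b : A, `|cmul a b| <= `|a| * `|b|;
  cstar_identity : forall a : A, `|cmul (star a) a| = `|a| ^+ 2
}.

#[short(type="cstarAlgType")]
HB.structure Definition CstarAlgebra (C : numClosedFieldType) :=
  {A of isCstarAlgebra C A & CompleteNormedModule C A}.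

(* The inner product is linear in its first argument and conjugate-linear in
   the second one. *)
HB.mixin Record isHilbert (C : numClosedFieldType) H
    & CompleteNormedModule C H := {
  hdot : {dot H for @Num.conj C};
  hdot_norm : forall u : H, hdot u u = `|u| ^+ 2
}.

#[short(type="hilbertType")]
HB.structure Definition Hilbert (C : numClosedFieldType) :=
  {H of isHilbert C H & CompleteNormedModule C H}.

Record bounded_op (C : numClosedFieldType) (H : normedModType C) := BoundedOp {
  bounded_op_fun :> {linear H -> H};
  bounded_op_continuous : continuous bounded_op_fun
}.

Definition is_adjoint (C : numClosedFieldType) (H : hilbertType C)
    (S T : bounded_op H) :=
  forall u v : H, hdot (T u) v = hdot u (S v).

Definition star_morphism (C : numClosedFieldType) (A : cstarAlgType C)
    (H : hilbertType C) (phi : A -> bounded_op H) :=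
  [/\ forall (c : C) (a b : A) (v : H), phi (c *: a + b) v = c *: phi a v + phi b v,
      forall (a b : A) (v : H), phi (cmul a b) v = phi a (phi b v) &
      forall a : A, is_adjoint (phi (star a)) (phi a)].

(* A representation need not be unital. *)
Record representation (C : numClosedFieldType) (A : cstarAlgType C) :=
    Representation {
  rep_space : hilbertType C;
  rep_fun :> A -> bounded_op rep_space;
  rep_star_morphism : star_morphism rep_fun
}.

Definition rker (C : numClosedFieldType) (A : cstarAlgType C)
    (phi : representation A) : set A :=
  [set a | forall v, phi a v = 0].

Definition closed_subspace (C : numClosedFieldType) (H : normedModType C)
    (W : set H) :=
  [/\ closed W, W 0 & forall (c : C) (u v : H), W u -> W v -> W (c *: u + v)].

(* The first clause excludes the zero representations, in particular the one
   on a one-dimensional space. *)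
Definition irreducible (C : numClosedFieldType) (A : cstarAlgType C)
    (pi : representation A) :=
  (exists a v, pi a v != 0) /\
  forall W : set (rep_space pi), closed_subspace W ->
    (forall a v, W v -> W (pi a v)) -> W = [set 0] \/ W = setT.

(* Stability under scalars follows from absorption, [A] being unital. *)
Definition closed_ideal (C : numClosedFieldType) (A : cstarAlgType C)
    (J : set A) :=
  [/\ closed J, J 0, forall a b, J a -> J b -> J (a + b) &
      forall a b, J a -> J (cmul b a) /\ J (cmul a b)].

Record Prim (C : numClosedFieldType) (A : cstarAlgType C) := PrimIdeal {
  prim_ideal :> set A;
  prim_idealP : exists2 pi : representation A,
    irreducible pi & prim_ideal = rker pi
}.

Definition prim_of (C : numClosedFieldType) (A : cstarAlgType C) (J : set A) :
    set (Prim A) :=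
  [set I : Prim A | ~ J `<=` I].

Definition jacobson_open (C : numClosedFieldType) (A : cstarAlgType C)
    (U : set (Prim A)) :=
  exists2 J : set A, closed_ideal J & U = prim_of J.

(* The sets Prim(J) form a topology on Prim(A).  Stability under unions uses that
   kernels of representations are closed, which is deduced from the automatic
   continuity of *-morphisms; the latter is obtained from square roots of
   [cone - x], [x] self-adjoint of norm at most 1/2. *)
Section JacobsonTopology.
Context (C : numClosedFieldType) (A : cstarAlgType C).
Context (arch : forall e : C, 0 < e -> exists n, 2^-1 ^+ n < e).
Implicit Types (a b x y z : A) (J : set A) (phi : representation A).

Lemma star_norm a : `|star a| = `|a|.
Proof.
suff h b : `|b| <= `|star b|.
  by apply/eqP; rewrite eq_le h andbT -{2}(starK a) h.
have [->|b0] := eqVneq b 0; first by rewrite normr0.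
have := norm_cmul (star b) b; rewrite cstar_identity expr2.
by rewrite ler_pM2r// normr_gt0.
Qed.

Lemma starN a : star (- a) = - star a.
Proof. by rewrite -scaleN1r starZ rmorphN1 scaleN1r. Qed.

Lemma star1 : star cone = cone :> A.
Proof.
have := congr1 star (cmula1 (star (cone : A))).
by rewrite starM starK cmula1.
Qed.

Lemma cmulBl x y z : cmul (x - y) z = cmul x z - cmul y z.
Proof. by rewrite addrC -scaleN1r cmul_linearl scaleN1r addrC. Qed.

Lemma cmulBr x y z : cmul x (y - z) = cmul x y - cmul x z.
Proof. by rewrite addrC -scaleN1r cmul_linearr scaleN1r addrC. Qed.

Let s x y := 2^-1 *: (x + cmul y y).

Let s_sub x y z : `|s x y - s x z| <= 2^-1 * ((`|y| + `|z|) * `|y - z|).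
Proof.
rewrite /s -scalerBr normrZ ger0_norm// ler_wpM2l//.
rewrite opprD addrACA subrr add0r.
have -> : cmul y y - cmul z z = cmul y (y - z) + cmul (y - z) z.
  by rewrite cmulBr cmulBl addrA subrK.
rewrite (le_trans (ler_normD _ _))// mulrDl lerD//.
  exact: norm_cmul.
by rewrite mulrC norm_cmul.
Qed.

Let half2 : 2^-1 + 2^-1 = 1 :> C.
Proof. by have := splitr (1 : C); rewrite !mul1r => <-. Qed.

Let sqrt_one_sub x : `|x| <= 2^-1 -> star x = x ->
  exists2 b, star b = b & cmul b b = cone - x.
Proof.
move=> x1 sx.
pose y := fun n => iter n (s x) 0.
have y1 n : `|y n| <= 2^-1.
  elim: n => [|n ih] /=; first by rewrite normr0.
  rewrite -[s x _](subrK (s x 0)) (le_trans (ler_normD _ _))//.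
  rewrite [leRHS](_ : _ = 2^-1 * 2^-1 + 2^-1 * 2^-1); last first.
    by rewrite -mulrDr half2 mulr1.
  apply: lerD.
    rewrite (le_trans (s_sub _ _ _))// normr0 addr0 subr0 ler_wpM2l//.
    rewrite (@le_trans _ _ (1 * `|y n|))//; last by rewrite mul1r.
    by rewrite ler_wpM2r// (le_trans ih)// invf_le1// ?ltr0n// ler1n.
  rewrite /s -[cmul 0 0]/(cmul 0 (0 : A)).
  have -> : cmul 0 0 = 0 :> A by rewrite -{2}(subrr (0 : A)) cmulBr subrr.
  by rewrite addr0 normrZ ger0_norm// ler_wpM2l.
have sy n : star (y n) = y n.
  elim: n => [|n ih] /=.
    by rewrite -{1}(subrr (0 : A)) starD starN subrr.
  by rewrite starZ starD starM ih sx fmorphV rmorph_nat.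
have step n : `|y n.+1 - y n| <= 2^-1 ^+ n.
  elim: n => [|n ih] /=.
    rewrite subr0 expr0 (le_trans (y1 1%N))// invf_le1// ?ltr0n//.
    by rewrite ler1n.
  rewrite (le_trans (s_sub _ _ _))// exprS ler_wpM2l//.
  rewrite -[leRHS]mul1r ler_pM// ?addr_ge0//.
  by rewrite -half2 lerD// ?(y1 n.+1).
have dist n m : `|y (n + m)%N - y n| <= 2 * 2^-1 ^+ n - 2 * 2^-1 ^+ (n + m).
  elim: m => [|m ih]; first by rewrite addn0 !subrr normr0.
  rewrite addnS -[y _](subrK (y (n + m)%N)) -addrA.
  rewrite (le_trans (ler_normD _ _))// (le_trans (lerD (step _) ih))//.
  rewrite exprS mulrA mulfV ?pnatr_eq0// mul1r.
  by rewrite addrCA (mulr_natl (_ ^+ (n + m))) mulr2n opprD (addrA (_ ^+ _)) subrr add0r.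
have dist1 n m : (n <= m)%N -> `|y m - y n| <= 2 * 2^-1 ^+ n.
  move=> nm; rewrite -(subnKC nm) (le_trans (dist _ _))// lerBlDr lerDl.
  by rewrite mulr_ge0// exprn_ge0.
have ycvg : cvgn y.
  apply/cauchy_cvgP/cauchy_ballP => e e0; near_simpl.
  have [N Ne] := arch (divr_gt0 e0 (ltr0n C 4)).
  exists ([set n | N <= n], [set n | N <= n])%N; first by split; exists N.
  move=> [n m] [/= Nn Nm]; rewrite -ball_normE /=.
  rewrite -(subrK (y N) (y n)) -addrA (le_lt_trans (ler_normD _ _))//.
  rewrite (distrC (y N)) (le_lt_trans (lerD (dist1 _ _ Nn) (dist1 _ _ Nm)))//.
  rewrite -mulrDl -natrD.
  by rewrite -ltr_pdivlMl ?ltr0n// mulrC.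
pose l := limn y.
have yl : y @ \oo --> l by exact: ycvg.
have dl e : 0 < e -> exists n, `|l - y n| < e /\ `|l - y n.+1| < e.
  move=> e0; move/cvgrPdist_lt: yl => /(_ e e0)[N _ Ny].
  by exists N; split; apply: Ny => //=.
have eps0 (t : A) (k : C) : 0 < k ->
    (forall e, 0 < e -> `|t| <= k * e) -> t = 0.
  move=> k0 h; apply/eqP; rewrite -normr_eq0; apply/negP => /negP t0.
  have tp : 0 < `|t| by rewrite lt_def t0 normr_ge0.
  have /h : 0 < k^-1 * (`|t| / 2) by rewrite !mulr_gt0// ?invr_gt0 ?ltr0n.
  rewrite mulrA mulfV ?gt_eqF// mul1r -{1}[`|t|]mulr1 ler_pM2l//.
  by rewrite invf_ge1 ?ltr0n// lern1.
have l1 : `|l| <= 1.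
  have [|n [hn _]] := dl 2^-1; first by rewrite invr_gt0 ltr0n.
  rewrite -(subrK (y n) l) (le_trans (ler_normD _ _))// -half2.
  by rewrite lerD// ltW.
have lfix : l = s x l.
  apply/subr0_eq/(eps0 _ 2); first by rewrite ltr0n.
  move=> e /dl[n [ln ln1]].
  rewrite (le_trans (ler_distD (y n.+1) _ _))//.
  rewrite mulr_natl mulr2n lerD// ?(ltW ln1)// (le_trans (s_sub _ _ _))//.
  rewrite (distrC (y n)) mulrA -[leRHS]mul1r ler_pM ?mulr_ge0 ?addr_ge0//; last exact: ltW.
  - rewrite (@le_trans _ _ (2^-1 * (1 + 1)))//; last first.
      by rewrite mulrDr !mulr1 half2.
    rewrite ler_wpM2l// lerD// (le_trans (y1 n))//.
    by rewrite invf_le1// ?ltr0n// ler1n.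
have ls : star l = l.
  apply/subr0_eq/(eps0 _ 2); first by rewrite ltr0n.
  move=> e /dl[n [/ltW ln _]].
  rewrite (le_trans (ler_distD (y n) _ _))//.
  rewrite mulr_natl mulr2n lerD//; last by rewrite distrC.
  by rewrite -{1}sy -starN -starD star_norm.
exists (cone - l); first by rewrite starD starN star1 ls.
rewrite cmulBl !cmulBr cmul1a cmula1 cmul1a.
have -> : cmul l l = 2 *: l - x.
  rewrite {3}lfix /s scalerA mulfV ?pnatr_eq0// scale1r.
  by rewrite addrC addrA addNr add0r.
by rewrite scaler_nat mulr2n (opprB l) (addrAC _ (- x)) addrK addrA subrK.
Unshelve. all: by end_near. Qed.

Lemma rep_lin phi (c : C) a b (v : rep_space phi) :
  phi (c *: a + b) v = c *: phi a v + phi b v.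
Proof. by have [] := rep_star_morphism phi. Qed.

Lemma repM phi a b (v : rep_space phi) : phi (cmul a b) v = phi a (phi b v).
Proof. by have [] := rep_star_morphism phi. Qed.

Lemma rep_star phi a (u v : rep_space phi) :
  hdot (phi a u) v = hdot u (phi (star a) v).
Proof. by have [_ _ /(_ a)] := rep_star_morphism phi; exact. Qed.

Lemma repD phi a b (v : rep_space phi) : phi (a + b) v = phi a v + phi b v.
Proof. by rewrite -[a]scale1r rep_lin !scale1r. Qed.

Lemma rep0 phi (v : rep_space phi) : phi 0 v = 0.
Proof. by apply: (@addrI _ (phi 0 v)); rewrite -repD !addr0. Qed.

Lemma repZ phi (c : C) a (v : rep_space phi) : phi (c *: a) v = c *: phi a v.
Proof. by rewrite -[c *: a]addr0 rep_lin rep0 addr0. Qed.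

Lemma repB phi a b (v : rep_space phi) : phi (a - b) v = phi a v - phi b v.
Proof. by rewrite repD -scaleN1r repZ scaleN1r. Qed.

Lemma hdot_ge0 (H : hilbertType C) (u : H) : 0 <= hdot u u.
Proof. by rewrite hdot_norm exprn_ge0. Qed.

Lemma rep_contract phi a (v : rep_space phi) :
  `|a| <= 2^-1 -> `|phi a v| <= `|v|.
Proof.
move=> a1.
have [||b sb bb] := @sqrt_one_sub (cmul (star a) a).
- rewrite cstar_identity expr2 (le_trans (ler_pM _ _ a1 a1))//.
  rewrite -[leRHS]mulr1 ler_wpM2l// invf_le1 ?ltr0n//.
  by rewrite ler1n.
- by rewrite starM starK.
rewrite -(@ler_pXn2r _ 2)// ?nnegrE// -!hdot_norm.
have sym u : hdot (phi cone u) v = hdot u (phi cone v).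
  by rewrite rep_star star1.
have h1 : hdot (phi a v) (phi a v) <= hdot (phi cone v) v.
  rewrite -subr_ge0; apply: le_trans (hdot_ge0 (phi b v)) _.
  by rewrite (rep_star b) sb -repM bb repB linearBr/= -sym repM -rep_star.
apply: (le_trans h1); rewrite -subr_ge0.
apply: le_trans (hdot_ge0 (v - phi cone v)) _.
by rewrite linearBl/= !linearBr/= -!sym -repM cmul1a subrr subr0.
Qed.

Lemma rker_closed phi : closed (rker phi).
Proof.
move=> a acl v; apply/eqP; rewrite -normr_eq0; apply/negP => /negP n0.
have n1 : 0 < `|phi a v| by rewrite lt_def n0 normr_ge0.
have v1 : 0 < `|v| + 1 by rewrite ltr_wpDl.
pose c := (`|v| + 1) / `|phi a v|.
have c0 : 0 < c by rewrite divr_gt0.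
have [|k [kk /=]] := acl (ball a (2^-1 / c)).
  by apply: nbhsx_ballx; rewrite divr_gt0// invr_gt0 ltr0n.
rewrite -ball_normE/= => ak.
have : `|c *: (a - k)| <= 2^-1.
  by rewrite normrZ gtr0_norm// mulrC -ler_pdivlMr// ltW.
move/(rep_contract (phi := phi)) => /(_ v).
rewrite repZ repB kk subr0 normrZ gtr0_norm// /c divfK//.
by rewrite -subr_ge0 opprD addrA subrr add0r oppr_ge0 ler10.
Qed.

Lemma rker_closed_ideal phi : closed_ideal (rker phi).
Proof.
split; first exact: rker_closed.
- by move=> v; rewrite rep0.
- by move=> a b ha hb v; rewrite repD ha hb addr0.
- by move=> a b ha; split => v; rewrite repM ha// linear0.
Qed.

Lemma irreducible_prime phi (J1 J2 : set A) : irreducible phi ->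
  closed_ideal J1 -> closed_ideal J2 -> J1 `&` J2 `<=` rker phi ->
  J1 `<=` rker phi \/ J2 `<=` rker phi.
Proof.
move=> [_ irr] [_ _ _ J1M] [_ _ _ J2M] J12.
pose W : set (rep_space phi) := [set w | forall j, J2 j -> phi j w = 0].
have [|w||] := irr W.
- split.
  + rewrite (_ : W = \bigcap_(j in J2) (phi j @^-1` [set 0])); last first.
      by apply/seteqP; split => w /= Ww j /Ww.
    apply: closed_bigI => j _; apply: preimage_closed; last first.
      exact/accessible_closed_set1/hausdorff_accessible/norm_hausdorff.
    by move=> x _; exact: bounded_op_continuous.
  + by move=> j _; rewrite linear0.
  + by move=> c u w Wu Ww j Jj; rewrite linearP Wu// Ww// scaler0 addr0.
- by move=> v Wv j Jj; rewrite -repM; exact: (Wv _ (J2M _ w Jj).2).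
- move=> W0; left => j1 Jj1 v.
  suff : W (phi j1 v) by rewrite W0.
  move=> j2 Jj2; rewrite -repM; apply: J12; split.
    by have [] := J1M _ j2 Jj1.
  by have [] := J2M _ j1 Jj2.
- by move=> WT; right => j Jj v; suff /(_ _ Jj) : W v by []; rewrite WT.
Qed.

Lemma prim_of_bigcup (T : Type) (J : T -> set A) :
  exists2 K : set A, closed_ideal K & prim_of K = \bigcup_i prim_of (J i).
Proof.
pose D := [set K : set A | closed_ideal K /\ \bigcup_i J i `<=` K].
exists (\bigcap_(K in D) K).
  split.
  - by apply: closed_bigI => K [[]].
  - by move=> K [[]].
  - by move=> a b ha hb K DK; case: (DK) => -[_ _ KD _] _; apply: KD; [exact: ha|exact: hb].
  - move=> a b ha; split => K DK; case: (DK) => -[_ _ _ /(_ a b (ha _ DK))[]] //.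
apply/seteqP; split => I /=.
  apply: contra_notP => nI a; apply.
  have [pi _ IE] := prim_idealP I.
  split; first by rewrite IE; exact: rker_closed_ideal.
  by move=> x [i _ Jx]; apply: contrapT => Ix; apply: nI; exists i => // /(_ _ Jx).
move=> [i _ nJ] KI; apply: nJ => a Ja; apply: KI => K [_]; apply.
by exists i.
Qed.

Lemma jacobson_openT : jacobson_open [set: Prim A].
Proof.
exists setT; first by split => //; exact: closedT.
apply/esym/seteqP; split => // I _ /= TI.
have [pi [[a [v /eqP]] + _] IE] := prim_idealP I.
by apply; have := TI a Logic.I; rewrite IE => /(_ v).
Qed.

Lemma jacobson_openI : setI_closed (@jacobson_open C A).
Proof.
move=> _ _ [J1 J1i ->] [J2 J2i ->]; exists (J1 `&` J2).
  case: J1i J2i => [c1 z1 d1 m1] [c2 z2 d2 m2]; split.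
  - exact: closedI.
  - by [].
  - by move=> a b [a1 a2] [b1 b2]; exact: conj (d1 _ _ a1 b1) (d2 _ _ a2 b2).
  - by move=> a b [/(m1 _ b)[? ?] /(m2 _ b)[? ?]].
apply/seteqP; split => I /=; last first.
  by move=> J12; split => JI; apply: J12 => a [a1 a2]; exact: JI.
have [pi pii IE] := prim_idealP I; rewrite /prim_of/= IE.
by move=> [n1 n2] /(irreducible_prime pii J1i J2i)[].
Qed.

Lemma jacobson_open_bigU (T : Type) (U : T -> set (Prim A)) :
  (forall i, jacobson_open (U i)) -> jacobson_open (\bigcup_i U i).
Proof.
move=> oU.
have /choice[J JU] i : exists J, closed_ideal J /\ U i = prim_of J.
  by have [J ? ?] := oU i; exists J.
have [K Ki KE] := prim_of_bigcup J; exists K => //.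
by rewrite KE; apply: eq_bigcupr => i _; have [] := JU i.
Qed.

End JacobsonTopology.

Lemma complex_half_expn (R : realType) (e : R[i]) :
  0 < e -> exists n, 2^-1 ^+ n < e.
Proof.
case: e => a b; rewrite ltcE/= => /andP[/eqP -> a0].
have [n _ /(_ n (leqnn n))/= h] := near_infty_natSinv_expn_lt (PosNum a0).
exists n; rewrite -[X in _ < X]/(a%:C).
rewrite (_ : 2^-1 ^+ n = (1 / 2 ^+ n)%:C); first by rewrite ltcR.
by rewrite div1r fmorphV rmorphXn rmorph_nat exprVn.
Qed.

HB.instance Definition _ (C : numClosedFieldType) (A : cstarAlgType C) :=
  gen_eqMixin (Prim A).
HB.instance Definition _ (C : numClosedFieldType) (A : cstarAlgType C) :=
  gen_choiceMixin (Prim A).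
HB.instance Definition _ (R : realType) (A : cstarAlgType R[i]) :=
  isOpenTopological.Build (Prim A) (@jacobson_openT _ A) (@jacobson_openI _ A)
    (@jacobson_open_bigU _ A (@complex_half_expn R)).

Lemma prim_openE (R : realType) (A : cstarAlgType R[i]) (U : set (Prim A)) :
  open U <-> jacobson_open U.
Proof. by []. Qed.

Definition opnorm (R : realType) (H : normedModType R[i]) (T : bounded_op H) : R :=
  sup [set r : R | exists2 v : H, `|v| <= 1 & `|T v| = r%:C].

(* Sets of representations are predicates: [set (representation A)] would be a
   universe inconsistency, Hilbert spaces being too large for [set]. *)
Definition rep_family (C : numClosedFieldType) (A : cstarAlgType C) :=
  representation A -> Prop.

Definition strictly_norming (R : realType) (A : cstarAlgType R[i])
    (F : rep_family A) :=
  forall a : A, exists2 phi, F phi & `|a| = (opnorm (phi a))%:C.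

Definition exhausting (R : realType) (A : cstarAlgType R[i])
    (F : rep_family A) :=
  forall pi : representation A, irreducible pi ->
    exists2 phi, F phi & rker phi `<=` rker pi.

Definition countable_nbhs_base (T : topologicalType) (x : T) :=
  exists B : set (set T), [/\ countable B, B `<=` nbhs x &
    forall U, nbhs x U -> exists2 V, B V & V `<=` U].

(* Main.v *)
(* The tool for both parts is that, for a closed ideal J and a self-adjoint x,
   the supremum of the spectrum of x modulo J is attained at a vector state of
   an irreducible representation killing J.  It is obtained as the GNS
   representation of an extreme point of the states vanishing on J at which x
   is maximal; extreme points come from Zorn's lemma applied to the faces of a
   sublinear functional.

   (1) Let I = ker pi have a countable neighborhood base Prim(J_n).  There are
   a_n of norm at most 1, vanishing in every representation killing J_n, and
   e_n <> 0 such that a_k e_n = e_n for k < n.  Then a = sum_n 2^(-n-1) a_n has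
   norm 1, but norm at most 1 - 2^(-n-1) in a representation killing J_n.  So a
   representation phi preserving the norm of a kills no J_n.  If ker phi were
   not contained in I, then Prim(ker phi) would contain some Prim(J_n), and ker
   phi would contain J_n.

   (2) The irreducible representations with kernel different from I are not
   exhausting, by T1, hence not strictly norming: some a attains its norm only
   at I.  Then the sets of primitive ideals at which a^* a exceeds
   |a|^2 - 1/(n+1) form a neighborhood base of I, because outside of Prim(J) the
   norm of a is at most its norm modulo J, which is attained. *)

Require Import Defs.
From HB Require Import structures.
From mathcomp Require Import all_boot all_order all_algebra.
From mathcomp Require Import complex.
From mathcomp Require Import all_classical all_reals all_analysis.
From mathcomp Require Import ring lra.
Set Implicit Arguments.
Unset Strict Implicit.
Unset Printing Implicit Defensive.
Import Order.TTheory GRing.Theory Num.Theory.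
Import numFieldNormedType.Exports.
Local Open Scope classical_set_scope.
Local Open Scope ring_scope.
Local Open Scope complex_scope.

Local Notation "a ** b" := (cmul a b) (at level 40, left associativity).

(** Neither a spectrum nor a functional calculus is available. A positive element is by definition
    the square of a self-adjoint one, and the order is built from one square root of 1 - x; the root
    commutes with all that commutes with x, which does the work of the functional calculus. The main
    obstacle is then that a^* a is such a square.

    The quotient by J is never formed either. Positivity modulo J means that adding some positive
    element of J makes the element positive, and the supremum of the spectrum modulo J is read off
    this cone. A real functional below that supremum is at once positive, normalized and zero on the
    positive elements of J, so that extreme functionals are pure states of the missing quotient.

    Functionals are real-valued throughout, as the order and the extreme point argument are real.
    The complex inner product of the GNS space is recovered from its norm by polarization. *)

Lemma gt0_real_complex (R : realType) (e : R[i]) : 0 < e ->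
  exists2 r : R, 0 < r & e = r%:C.
Proof. by case: e => a b; rewrite ltcE/= => /andP[/eqP -> ?]; exists a. Qed.

(** * Square roots and positive elements *)

Section CstarAlgebra.
Context (R : realType) (A : cstarAlgType R[i]).
Implicit Types (a b x y z : A) (c t : R[i]).

Lemma cmulDl a b z : (a + b) ** z = a ** z + b ** z.
Proof. by rewrite -[a]scale1r cmul_linearl !scale1r. Qed.

Lemma cmulDr z a b : z ** (a + b) = z ** a + z ** b.
Proof. by rewrite -[a]scale1r cmul_linearr !scale1r. Qed.

Lemma cmul0l z : 0 ** z = 0 :> A.
Proof. by rewrite -{1}(subrr (0 : A)) cmulBl subrr. Qed.

Lemma cmul0r z : z ** 0 = 0 :> A.
Proof. by rewrite -{1}(subrr (0 : A)) cmulBr subrr. Qed.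

Lemma cmulZl c a z : (c *: a) ** z = c *: (a ** z).
Proof. by rewrite -[c *: a]addr0 cmul_linearl cmul0l addr0. Qed.

Lemma cmulZr c z a : z ** (c *: a) = c *: (z ** a).
Proof. by rewrite -[c *: a]addr0 cmul_linearr cmul0r addr0. Qed.

Lemma cmulNl a z : (- a) ** z = - (a ** z).
Proof. by rewrite -scaleN1r cmulZl scaleN1r. Qed.

Lemma cmulNr z a : z ** (- a) = - (z ** a).
Proof. by rewrite -scaleN1r cmulZr scaleN1r. Qed.

Lemma starB a b : star (a - b) = star a - star b.
Proof. by rewrite starD starN. Qed.

Lemma star0 : star 0 = 0 :> A.
Proof. by rewrite -{1}(subrr (0 : A)) starB subrr. Qed.

Lemma starZ_ge0 c a : 0 <= c -> star (c *: a) = c *: star a.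
Proof. by move=> c0; rewrite starZ (CrealP (ger0_real c0)). Qed.

Definition cmulE := (cmulDl, cmulDr, cmulBl, cmulBr, cmulZl, cmulZr, cmulNl,
  cmulNr, cmul0l, cmul0r, @cmul1a R[i] A, @cmula1 R[i] A, @cmulA R[i] A).

Lemma cvg_cmul (T : Type) (F : set_system T) (FF : Filter F) (f g : T -> A) a b :
  f @ F --> a -> g @ F --> b -> (f t ** g t) @[t --> F] --> a ** b.
Proof.
move=> fa gb; apply/cvgrPdist_le => e e0.
have a1 : 0 < `|a| + 1 by rewrite ltr_wpDl.
have b1 : 0 < `|b| + 1 by rewrite ltr_wpDl.
have [ea eb] : 0 < e / 2 / (`|a| + 1) /\ 0 < e / 2 / (`|b| + 1).
  by rewrite !divr_gt0.
move/cvgrPdist_le : fa => /(_ _ eb) fa.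
move/cvgrPdist_le : (gb) => /(_ _ ea) ga.
move/cvgrPdist_le : gb => /(_ _ ltr01) gb.
near=> t.
have -> : a ** b - f t ** g t = a ** (b - g t) + (a - f t) ** g t.
  by rewrite cmulBr cmulBl addrA subrK.
rewrite (le_trans (ler_normD _ _))// [leRHS]splitr; apply: lerD.
  rewrite (le_trans (norm_cmul _ _))//.
  rewrite (@le_trans _ _ ((`|a| + 1) * (e / 2 / (`|a| + 1))))//; last first.
    by rewrite mulrC divfK ?gt_eqF.
  by rewrite ler_pM// ?lerDl//; near: t.
rewrite (le_trans (norm_cmul _ _))//.
rewrite (@le_trans _ _ ((e / 2 / (`|b| + 1)) * (`|b| + 1)))//; last first.
  by rewrite divfK ?gt_eqF.
rewrite ler_pM//; first by near: t.
rewrite -[g t](subrK b) (le_trans (ler_normD _ _))// addrC lerD2l distrC.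
by near: t.
Unshelve. all: by end_near. Qed.

Lemma cvg_star (T : Type) (F : set_system T) (FF : Filter F) (f : T -> A) a :
  f @ F --> a -> star (f t) @[t --> F] --> star a.
Proof.
move=> /cvgrPdist_le fa; apply/cvgrPdist_le => e /fa.
by apply: filterS => t; rewrite -starB star_norm.
Qed.

(* The iterates [(x + y ^+ 2) / 2] of [0] have nonnegative coefficients as
   polynomials in [x], so their value at [x = 1] dominates their norm. *)
Lemma sqrt_one_sub x : `|x| <= 1 -> star x = x ->
  exists b, [/\ star b = b, b ** b = cone - x, `|cone - b| <= 1 &
    forall z, z ** x = x ** z -> z ** b = b ** z].
Proof.
move=> x1 sx.
pose s y := 2^-1 *: (x + y ** y).
pose y := fun n => iter n s 0.
pose w := fun n => iter n (fun r : R => 2^-1 * (1 + r ^+ 2)) 0.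
have wS n : w n.+1 = 2^-1 * (1 + w n ^+ 2) by [].
have yS n : y n.+1 = s (y n) by [].
have w0 n : 0 <= w n.
  by elim: n => // n ih; rewrite wS mulr_ge0// addr_ge0// exprn_ge0.
have w1 n : w n <= 1.
  elim: n => [|n ih]; first exact: ler01.
  have := w0 n; rewrite wS; nra.
have yw n : `|y n| <= (w n)%:C.
  elim: n => [|n ih]; first by rewrite normr0.
  rewrite yS wS /s normrZ ger0_norm ?invr_ge0//.
  rewrite rmorphM fmorphV rmorph_nat ler_wpM2l ?invr_ge0//.
  rewrite (le_trans (ler_normD _ _))// rmorphD rmorph1 lerD//.
  by rewrite (le_trans (norm_cmul _ _))// rmorphXn expr2 ler_pM.
have yw1 n : `|y n.+1 - y n| <= (w n.+1 - w n)%:C.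
  elim: n => [|n ih].
    rewrite -[y 0%N]/(0 : A) -[w 0%N]/(0 : R) !subr0; exact: yw.
  rewrite (yS n.+1) {2}(yS n) (wS n.+1) {2}(wS n) /s -scalerBr normrZ.
  rewrite ger0_norm ?invr_ge0// opprD addrACA subrr add0r.
  have -> : y n.+1 ** y n.+1 - y n ** y n =
      y n.+1 ** (y n.+1 - y n) + (y n.+1 - y n) ** y n.
    by rewrite cmulBr cmulBl addrA subrK.
  rewrite -mulrBr rmorphM fmorphV rmorph_nat ler_wpM2l ?invr_ge0//.
  rewrite (_ : 1 + _ - _ = w n.+1 * (w n.+1 - w n) + (w n.+1 - w n) * w n).
    2: by ring.
  rewrite rmorphD (le_trans (ler_normD _ _))// lerD//;
    by rewrite (le_trans (norm_cmul _ _))// rmorphM ler_pM.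
have wle n : w n <= w n.+1.
  by rewrite -subr_ge0 -(@lecR R); apply: le_trans (yw1 n).
have wnd : nondecreasing_seq w by apply/nondecreasing_seqP.
have dist n m : (n <= m)%N -> `|y m - y n| <= (w m - w n)%:C.
  move=> /subnKC <-; elim: (m - n)%N => [|k ih].
    by rewrite addn0 !subrr normr0.
  rewrite addnS -(subrK (y (n + k)%N) (y _.+1)) -addrA.
  rewrite (le_trans (ler_normD _ _))// (le_trans (lerD (yw1 _) ih))//.
  by rewrite -rmorphD addrA subrK.
have wcvg : cvgn w.
  by apply: nondecreasing_is_cvgn => //; exists 1 => _ [n _ <-].
have ycvg : cvgn y.
  apply/cauchy_cvgP/cauchy_ballP => e e0; near_simpl.
  have [r r0 ->] := gt0_real_complex e0.
  move/cvgrPdist_lt : (wcvg) => /(_ (r / 2))[|N _ Nw]; first by rewrite divr_gt0.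
  exists ([set n | N <= n], [set n | N <= n])%N; first by split; exists N.
  move=> [n m] [/= Nn Nm]; rewrite -ball_normE /=.
  rewrite -(subrK (y N) (y n)) -addrA (le_lt_trans (ler_normD _ _))//.
  rewrite (distrC (y N)) (le_lt_trans (lerD (dist _ _ Nn) (dist _ _ Nm)))//.
  rewrite -rmorphD ltcR.
  have wlim := nondecreasing_cvgn_le wnd wcvg.
  have := Nw N (leqnn N); rewrite /= ger0_norm ?subr_ge0//.
  by have := wlim n; have := wlim m; lra.
pose l := limn y.
have yl : y @ \oo --> l by exact: ycvg.
(* A closed property of 0 that [s] preserves passes to the limit; self-adjointness and commutation
   are obtained this way. *)
have lS S : closed S -> S 0 -> (forall z, S z -> S (s z)) -> S l.
  move=> Sc S0 Ss; apply: (closed_cvg S Sc _ _ yl); apply: nearW => n.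
  by elim: n => // n ih; rewrite yS; exact: Ss.
have lfix : l = s l.
  have yl1 : s (y n) @[n --> \oo] --> l.
    rewrite (_ : (fun n => s (y n)) = (fun n => y (n + 1)%N)).
      by rewrite (cvg_shiftn 1 y).
    by apply/funext => n; rewrite addn1.
  apply: (cvg_unique _ yl1); first exact: norm_hausdorff.
  by apply: cvgZr; apply: cvgD; [exact: cvg_cst|exact: cvg_cmul].
have cl0 (f : A -> A) : continuous f -> closed [set z | f z = 0].
  move=> fc; apply: (@preimage_closed _ _ f [set 0]) => [z _|]; first exact: fc.
  exact/accessible_closed_set1/hausdorff_accessible/norm_hausdorff.
have comm z : z ** x = x ** z -> z ** l = l ** z.
  move=> zx; apply/eqP; rewrite -subr_eq0; apply/eqP.
  apply: (lS [set u | z ** u - u ** z = 0]).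
  - apply: cl0 => u; apply: cvgB; apply: cvg_cmul => //; exact: cvg_cst.
  - by rewrite /= cmul0l cmul0r subrr.
  - move=> u /= /eqP; rewrite subr_eq0 => /eqP zu.
    rewrite /s cmulZl cmulZr cmulDl cmulDr zx cmulA zu -!cmulA zu.
    by rewrite subrr.
(* (1 - l)^2 = 1 - 2 l + l^2, and the fixed point equation reads l^2 = 2 l - x. *)
exists (cone - l); split.
- rewrite starB star1; congr (_ - _).
  apply/eqP; rewrite -subr_eq0; apply/eqP.
  apply: (lS [set u | star u - u = 0]).
  + by apply: cl0 => u; apply: cvgB => //; exact: cvg_star.
  + by rewrite /= star0 subrr.
  + move=> u /= /eqP; rewrite subr_eq0 => /eqP zu.
    by rewrite /s starZ_ge0 ?invr_ge0// starD starM sx zu subrr.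
- rewrite cmulBl !cmulBr cmul1a cmula1 cmul1a.
  have -> : l ** l = 2 *: l - x.
    rewrite {3}lfix /s scalerA mulfV ?pnatr_eq0// scale1r.
    by rewrite addrC addrA addNr add0r.
  by rewrite scaler_nat mulr2n (opprB l) (addrAC _ (- x)) addrK addrA subrK.
- rewrite opprB addrCA subrr addr0.
  apply/ler_addgt0Pr => e e0; move/cvgrPdist_le : yl => /(_ _ e0)[N _ Ny].
  rewrite -(subrK (y N) l) (le_trans (ler_normD _ _))// addrC lerD//.
    by rewrite (le_trans (yw N))// (@lecR R _ 1).
  exact: Ny N (leqnn N).
- by move=> z /comm zl; rewrite cmulBl cmulBr cmul1a cmula1 zl.
Unshelve. all: by end_near. Qed.

End CstarAlgebra.

Section Positive.
Context (R : realType) (A : cstarAlgType R[i]).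
Implicit Types (a b x y z : A) (c t : R[i]).

Lemma norm_sqr_sa b : star b = b -> `|b ** b| = `|b| ^+ 2.
Proof. by move=> sb; rewrite -cstar_identity sb. Qed.

Lemma sqr_sa_eq0 b : star b = b -> b ** b = 0 -> b = 0.
Proof.
move=> sb bb; have := norm_sqr_sa sb; rewrite bb normr0 => /esym/eqP.
by rewrite sqrf_eq0 normr_eq0 => /eqP.
Qed.

Lemma norm_cone_le1 : `|cone : A| <= 1.
Proof.
have [->|n0] := eqVneq (cone : A) 0; first by rewrite normr0.
have n1 : 0 < `|cone : A| by rewrite normr_gt0.
have := norm_sqr_sa (@star1 _ A).
by rewrite cmul1a => h; rewrite -(ler_pM2l n1) mulr1 -expr2 -h.
Qed.

Lemma norm_scalar t : 0 <= t -> `|t *: cone : A| <= t.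
Proof.
by move=> t0; rewrite normrZ ger0_norm// -[leRHS]mulr1 ler_wpM2l// norm_cone_le1.
Qed.

(* [b + 'i c] is a multiple of a unitary. *)
Lemma norm_sqr_le b (c : A) t : 0 <= t -> star b = b -> star c = c ->
  b ** c = c ** b -> b ** b + c ** c = t *: cone -> `|b ** b| <= t.
Proof.
move=> t0 sb sc bc bct; pose u := b + 'i *: c.
have su : star u = b - 'i *: c.
  rewrite /u starD starZ sb sc -scaleNr; congr (_ + _ *: _).
  by apply/eqP; rewrite eq_complex/= oppr0 !eqxx.
have uu : star u ** u = t *: cone.
  rewrite su /u !cmulE bc scalerA -expr2 sqr_i scaleN1r opprK.
  by rewrite addrA addrK.
have nu : `|u| ^+ 2 <= t by rewrite -cstar_identity uu norm_scalar.
have b2 : b = 2^-1 *: (u + star u).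
  rewrite su /u addrACA subrr addr0 -mulr2n -(scaler_nat 2 b) scalerA.
  by rewrite mulVf ?pnatr_eq0// scale1r.
rewrite norm_sqr_sa//; apply: le_trans nu; rewrite ler_pXn2r ?nnegrE//.
rewrite b2 normrZ ger0_norm ?invr_ge0// ler_pdivrMl ?ltr0n//.
by rewrite (le_trans (ler_normD _ _))// star_norm mulr_natl mulr2n.
Qed.

Definition pos x := exists2 b, star b = b & x = b ** b.

Lemma pos_star_id x : pos x -> star x = x.
Proof. by move=> [b sb ->]; rewrite starM sb. Qed.

Lemma posZ c x : 0 <= c -> pos x -> pos (c *: x).
Proof.
move=> c0 [b sb ->]; exists (sqrtC c *: b).
  by rewrite starZ_ge0 ?sqrtC_ge0 ?sb.
by rewrite !cmulE scalerA -expr2 sqrtCK.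
Qed.

Lemma pos0 : pos 0.
Proof. by exists 0; rewrite ?star0 ?cmul0l. Qed.

Lemma pos_scalar t : 0 <= t -> pos (t *: cone).
Proof. by move=> t0; apply: posZ => //; exists cone; rewrite ?star1 ?cmul1a. Qed.

(** [sqrt_one_sub] rescaled by [t]. The norm bound on [b] is the hypothesis again, for [sqrtC t], so
    that roots can be iterated, as in [abs_root]. *)
Lemma sqrt_near_scalar t x : star x = x -> `|t *: cone - x| <= t ->
  exists b, [/\ star b = b, b ** b = x, `|sqrtC t *: cone - b| <= sqrtC t &
    forall z, z ** x = x ** z -> z ** b = b ** z].
Proof.
move=> sx xt; have t0 : 0 <= t by apply: le_trans xt.
have [t1|tn] := eqVneq t 0.
  move: xt; rewrite t1 scale0r sub0r normrN normr_le0 => /eqP ->.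
  by exists 0; rewrite star0 cmul0l sqrtC0 scale0r subrr normr0; split.
have tp : 0 < t by rewrite lt_def tn.
have [||b [sb bb b1 bc]] := @sqrt_one_sub _ A (cone - t^-1 *: x).
- rewrite -(ler_pM2l tp) mulr1 -{1}(ger0_norm t0) -normrZ scalerBr scalerA.
  by rewrite divff// scale1r.
- by rewrite starB star1 starZ_ge0 ?invr_ge0// sx.
have s0 : 0 <= sqrtC t by rewrite sqrtC_ge0.
exists (sqrtC t *: b); split.
- by rewrite starZ_ge0 ?sb.
- rewrite !cmulE scalerA -expr2 sqrtCK bb opprB addrCA subrr addr0.
  by rewrite scalerA divff// scale1r.
- by rewrite -scalerBr normrZ ger0_norm// -[leRHS]mulr1 ler_wpM2l.
- move=> z zx; rewrite !cmulE bc// !cmulE zx.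
  by [].
Qed.

(** A root [c] of 1 - x/t makes t - x a square. It commutes with [b], and the two squares add up to
    t, so [norm_sqr_le] applies. *)
Lemma pos_norm_sub t x : pos x -> `|x| <= t -> `|t *: cone - x| <= t.
Proof.
move=> [b sb ->] bt; have t0 : 0 <= t by apply: le_trans bt.
have [t1|tn] := eqVneq t 0.
  by move: bt; rewrite t1 scale0r sub0r normrN.
have tp : 0 < t by rewrite lt_def tn.
have [||c [sc cc _ cb]] := @sqrt_one_sub _ A (t^-1 *: (b ** b)).
- by rewrite normrZ ger0_norm ?invr_ge0// mulrC ler_pdivrMr// mul1r.
- by rewrite starZ_ge0 ?invr_ge0// starM sb.
have -> : t *: cone - b ** b = (sqrtC t *: c) ** (sqrtC t *: c).
  rewrite !cmulE scalerA -expr2 sqrtCK cc scalerBr scalerA.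
  by rewrite divff// scale1r.
apply: (@norm_sqr_le _ b) => //.
- by rewrite starZ_ge0 ?sqrtC_ge0 ?sc.
- by rewrite !cmulE cb// !cmulE.
- rewrite !cmulE scalerA -expr2 sqrtCK cc scalerBr scalerA.
  by rewrite divff// scale1r subrK.
Qed.

(** Trades the existence of a root for a norm inequality, to which the triangle inequality applies:
    this is how sums of positive elements are handled. *)
Lemma posP t x : `|x| <= t -> pos x <-> star x = x /\ `|t *: cone - x| <= t.
Proof.
move=> xt; split=> [px|[sx]].
  by split; [exact: pos_star_id|exact: pos_norm_sub].
by move=> /(sqrt_near_scalar sx)[b [sb <- _ _]]; exists b.
Qed.

Lemma posD x y : pos x -> pos y -> pos (x + y).
Proof.
move=> px py; apply/(@posP (`|x| + `|y|)); first exact: ler_normD.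
split; first by rewrite starD !pos_star_id.
rewrite scalerDl opprD addrACA (le_trans (ler_normD _ _))// lerD//;
  exact: pos_norm_sub.
Qed.

Lemma pos_scalar_sub t x : pos x -> `|x| <= t -> pos (t *: cone - x).
Proof.
move=> px xt; have t0 : 0 <= t by apply: le_trans xt.
have sx := pos_star_id px.
apply/(@posP t); first exact: pos_norm_sub.
by rewrite starB sx starZ_ge0// star1 opprB addrCA subrr addr0.
Qed.

(** The root of t - x can be chosen to commute with the root of x; their squares add up to t. *)
Lemma pos_norm_le t x : 0 <= t -> pos x -> pos (t *: cone - x) -> `|x| <= t.
Proof.
move=> t0 [b sb ->] ptx; set y := t *: cone - _ in ptx.
have := pos_norm_sub ptx (lexx _).
case/(sqrt_near_scalar (pos_star_id ptx)) => c [sc cc _ cb].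
apply: (norm_sqr_le t0 sb sc); last by rewrite cc addrC subrK.
by apply: cb; rewrite /y !cmulE.
Qed.

Lemma pos_mono x y : pos x -> pos (y - x) -> `|x| <= `|y|.
Proof.
move=> px pyx; apply: pos_norm_le => //.
have py : pos y by rewrite -(subrK x y); exact: posD.
rewrite -(subrK y (_ *: cone)) -addrA.
by apply: posD => //; exact: pos_scalar_sub.
Qed.

Lemma pos_antisym x : pos x -> pos (- x) -> x = 0.
Proof.
move=> px; rewrite -sub0r => /(pos_mono px); rewrite normr0 normr_le0.
by move/eqP.
Qed.

(** The absolute value of [y] is [s ** s]; keeping its root [s] makes it visibly positive. *)
Lemma abs_root y : star y = y -> exists s, [/\ star s = s,
  (s ** s) ** (s ** s) = y ** y & forall z, z ** y = y ** z -> z ** s = s ** z].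
Proof.
move=> sy; have py : pos (y ** y) by exists y.
have := pos_norm_sub py (lexx _).
case/(sqrt_near_scalar (pos_star_id py)) => b [sb bb b1 bc].
have [s [ss ssb _ sc]] := sqrt_near_scalar sb b1.
exists s; rewrite ssb; split=> // z zy; apply/sc/bc.
by rewrite cmulA zy -!cmulA zy.
Qed.

Lemma sa_cmul a b : star a = a -> star b = b -> a ** b = b ** a ->
  star (a ** b) = a ** b.
Proof. by move=> sa sb ab; rewrite starM sa sb. Qed.

Lemma comm_cmul z a b : z ** a = a ** z -> z ** b = b ** z ->
  z ** (a ** b) = a ** b ** z.
Proof. by move=> za zb; rewrite cmulA za -cmulA zb cmulA. Qed.

Lemma commB z a b : z ** a = a ** z -> z ** b = b ** z ->
  z ** (a - b) = (a - b) ** z.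
Proof. by move=> za zb; rewrite cmulBl cmulBr za zb. Qed.

(* With [z = a q] and [q] twice the negative part of [a^* a], one gets
   [z^* z <= 0 <= z z^*]; comparing norms forces [z = 0]. *)
Lemma pos_star_cmul a : pos (star a ** a).
Proof.
set y := star a ** a.
have sy : star y = y by rewrite starM starK.
have [s [ss ssy sc]] := abs_root sy.
have ys : y ** s = s ** y by exact: sc.
pose r := s ** s; pose q := r - y.
have sr : s ** r = r ** s by rewrite /r cmulA.
have yr : y ** r = r ** y by exact: comm_cmul.
have rq : r ** q = q ** r by apply: commB.
have sq : s ** q = q ** s by apply: commB.
have qsa : star q = q by rewrite /q starB sy starM ss.
have yq : y ** q = - (r ** q).
  rewrite /q !cmulBr yr -ssy -/r opprB; congr (_ - _).
have q2 : q ** q = 2 *: (q ** r).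
  by rewrite {1}/q cmulBl yq opprK rq scaler_nat mulr2n.
pose v := s ** q.
have sv : star v = v by exact: sa_cmul.
pose z := a ** q.
have zz : star z ** z = - (v ** v).
  rewrite starM qsa cmulA -(cmulA q) -/y -cmulA yq cmulNr; congr (- _).
  by rewrite /v /r {1}sq !cmulA.
have pv : pos (v ** v) by exists v.
pose w := z ** star z.
have pw : pos w.
  pose g := z + star z; pose h := 'i *: (z - star z).
  have sg : star g = g by rewrite starD starK addrC.
  have sh : star h = h.
    rewrite starZ starB starK -opprB scalerN -scaleNr; congr (_ *: _).
    by apply/eqP; rewrite eq_complex/= oppr0 opprK !eqxx.
  have -> : w = 2^-1 *: (g ** g + h ** h) + v ** v.
    pose d := z - star z.
    have -> : h ** h = - (d ** d).
      by rewrite cmulZl cmulZr scalerA -expr2 sqr_i scaleN1r.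
    have gd : g - d = star z + star z by rewrite /g /d opprB addrC addrA subrK.
    have -> : g ** g - d ** d = g ** (g - d) + (g - d) ** d.
      by rewrite cmulBr cmulBl addrA subrK.
    rewrite gd cmulDl cmulDr addrACA.
    have -> : g ** star z + star z ** d = w - v ** v.
      rewrite /g /d cmulDl cmulBr -/w -zz -addrA; congr (_ + _).
      by rewrite addrCA subrr addr0.
    rewrite -mulr2n -(scaler_nat 2 (w - _)) scalerA mulVf ?pnatr_eq0// scale1r.
    by rewrite subrK.
  apply: posD => //; apply: posZ; first by rewrite invr_ge0.
  by apply: posD; [exists g|exists h].
(* [t] is the norm of both [w] and v^2. The element z^* (t - w) z has norm at most t^2, but its
   opposite is t v^2 + v^4 >= 2 v^4, of norm at least 2 t^2; hence t = 0. *)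
pose t := `|z| ^+ 2.
have wt : `|w| = t by rewrite /w -{1}(starK z) cstar_identity star_norm.
have vt : `|v ** v| = t by rewrite -normrN -zz cstar_identity.
have t0 : 0 <= t by rewrite exprn_ge0.
have zwz : star z ** (t *: cone - w) ** z = - (t *: (v ** v) + v ** v ** (v ** v)).
  have -> : star z ** (t *: cone - w) ** z =
    t *: (star z ** z) - star z ** z ** (star z ** z)
    by rewrite cmulBr cmulBl cmulZr cmula1 cmulZl /w !cmulA.
  by rewrite zz cmulNl cmulNr opprK scalerN opprD.
have le1 : `|t *: (v ** v) + v ** v ** (v ** v)| <= t ^+ 2.
  rewrite -normrN -zwz (le_trans (norm_cmul _ _))//.
  rewrite (le_trans (ler_wpM2r _ (norm_cmul _ _)))// star_norm.
  rewrite mulrAC -expr2 expr2 -/t ler_wpM2l//.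
  by apply: pos_norm_sub => //; rewrite wt.
have vK : pos (t *: cone - v ** v) by apply: pos_scalar_sub => //; rewrite vt.
have le2 : `|2 *: (v ** v ** (v ** v))| <= t ^+ 2.
  apply: le_trans le1; apply: pos_mono.
    by apply: posZ; [exact: ler0n|exists (v ** v); rewrite // starM sv].
  have [k [sk kk _ kc]] :=
    sqrt_near_scalar (pos_star_id vK) (pos_norm_sub vK (lexx _)).
  have vk : v ** k = k ** v.
    by apply: kc; rewrite cmulBr cmulBl cmulZr cmulZl cmula1 cmul1a (cmulA v v v).
  have -> : t *: (v ** v) + v ** v ** (v ** v) - 2 *: (v ** v ** (v ** v)) =
      (v ** k) ** (v ** k).
    rewrite -(cmulA v k (v ** k)) (cmulA k v k) -vk -(cmulA v k k) kk.
    rewrite !cmulBr !cmulZr cmula1 (cmulA v v (v ** v)).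
    by rewrite scaler_nat mulr2n opprD addrA addrK.
  by exists (v ** k) => //; exact: sa_cmul.
have t1 : t = 0.
  have svv : star (v ** v) = v ** v by rewrite starM sv.
  move: le2; rewrite normrZ (norm_sqr_sa svv) vt ger0_norm//.
  rewrite mulr_natl mulr2n gerDl => h; apply/eqP.
  by rewrite -(sqrf_eq0 t) eq_le h exprn_ge0.
have v0 : v = 0.
  by apply: sqr_sa_eq0 => //; apply/eqP; rewrite -normr_eq0 vt t1.
have q0 : q = 0.
  have qr : q ** r = 0 by rewrite -rq /r -cmulA -/v v0 cmul0r.
  by apply: sqr_sa_eq0; rewrite ?q2 ?qr ?scaler0.
by exists s => //; apply/esym/eqP; rewrite -subr_eq0 -/r -/q q0.
Qed.

End Positive.

Section PosNeg.
Context (R : realType) (A : cstarAlgType R[i]).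
Implicit Types (a b x y z : A) (c t : R[i]).

Lemma pos_conj a x : pos x -> pos (star a ** x ** a).
Proof.
move=> [b sb ->]; rewrite (_ : _ ** a = star (b ** a) ** (b ** a)).
  exact: pos_star_cmul.
by rewrite starM sb !cmulA.
Qed.

Lemma pos_addr_eq0 x y : pos x -> pos y -> x + y = 0 -> x = 0.
Proof.
move=> px py xy; apply: pos_antisym => //.
by rewrite -(addKr x y) xy addr0 in py.
Qed.

(* With [t = u ^+ 2] the absolute value of [q] and [m = t - q], the squares of
   [t m] and [s u m] have a vanishing positive combination. *)
Let pos_of_sqr (s q : A) : star s = s -> star q = q -> s ** q = q ** s ->
  q ** q = 2 *: (s ** (s ** q)) -> pos q.
Proof.
move=> ss sq sqC q2.
have [u [su uu uC]] := abs_root sq.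
have suC := uC _ sqC; have quC := uC q erefl.
have tE (x : A) : u ** (u ** x) = (u ** u) ** x by rewrite cmulA.
move: (u ** u) uu tE (comm_cmul quC quC) (comm_cmul suC suC)
  (comm_cmul (erefl (u ** u)) erefl) (sa_cmul su su erefl).
move=> t tt tE qtC stC utC' st.
have utC : u ** t = t ** u by have := tE cone; rewrite !cmula1 => <-; rewrite cmulA.
pose m := t - q.
have sm : star m = m by rewrite starB st sq.
have um : u ** m = m ** u by apply: commB.
have smC : s ** m = m ** s by apply: commB.
have tm : t ** m = m ** t by apply: commB.
have qm : q ** m = - (t ** m) by rewrite !cmulBr tt qtC opprB.
move: (m) sm um smC tm qm (erefl : m = t - q) => {}m sm um smC tm qm mE.
have key : t ** (t ** m) + 2 *: (s ** (s ** (t ** m))) = 0.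
  have -> : t ** (t ** m) = q ** (q ** m).
    by rewrite qm cmulNr (cmulA q) qtC -(cmulA t) qm cmulNr opprK.
  by rewrite cmulA q2 cmulZl -!cmulA qm !cmulNr scalerN addNr.
have X0 : t ** m = 0.
  apply: sqr_sa_eq0; first exact: sa_cmul.
  apply: (@pos_addr_eq0 _ (2 *: ((s ** (u ** m)) ** (s ** (u ** m))))).
  - by exists (t ** m) => //; exact: sa_cmul.
  - apply: posZ; first exact: ler0n.
    exists (s ** (u ** m)) => //; apply: sa_cmul => //; first exact: sa_cmul.
    exact: comm_cmul.
  - rewrite {1}tm -cmulA.
    rewrite (_ : _ ** (s ** (u ** m)) = m ** (s ** (s ** (t ** m)))).
      by rewrite -cmulZr -cmulDr key cmul0r.
    rewrite {1}um (cmulA s m u) smC -!cmulA; congr (_ ** (_ ** _)).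
    by rewrite (cmulA u) -suC -cmulA tE.
suff m0 : m = 0.
  exists u => //; move: mE; rewrite m0 => /esym/eqP; rewrite subr_eq0 => /eqP <-.
  by have := tE cone; rewrite !cmula1.
apply: sqr_sa_eq0 => //.
by rewrite {1}mE cmulBl qm opprK X0 addr0.
Qed.

(** The usual parts (|y| + y)/2 and (|y| - y)/2, with |y| = s^2. For z = y or -y, the element |y| -
    z satisfies q^2 = 2 s^2 q, which [pos_of_sqr] turns into positivity. *)
Lemma pos_neg_part y : star y = y ->
  exists p q : A, [/\ pos p, pos q, y = p - q & p ** q = 0].
Proof.
move=> sy; have [s [ss sE sC]] := abs_root sy.
have syC := sC y erefl.
pose r := s ** s.
have sr : star r = r by rewrite starM ss.
have ryC : y ** r = r ** y by apply: comm_cmul.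
have h z : star z = z -> s ** z = z ** s -> y ** y = z ** z -> pos (r - z).
  move=> sz szC zz; have rzC : r ** z = z ** r by apply/esym/comm_cmul.
  apply: (pos_of_sqr ss); first by rewrite starB sr sz.
    by rewrite cmulBl cmulBr szC /r cmulA.
  rewrite (cmulA s) -/r cmulBr !cmulBl -zz -sE -/r rzC scaler_nat mulr2n.
  by rewrite opprB cmulBr rzC.
exists (2^-1 *: (r + y)), (2^-1 *: (r - y)); split.
- apply: posZ; first by rewrite invr_ge0.
  rewrite -[y]opprK; apply: h; first by rewrite starN sy.
    by rewrite cmulNr cmulNl syC.
  by rewrite cmulNr cmulNl opprK.
- by apply: posZ; [rewrite invr_ge0|exact: h].
- rewrite -scalerBr opprB addrCA (addrAC r) subrr add0r.
  by rewrite -mulr2n -(scaler_nat 2 y) scalerA mulVf ?pnatr_eq0// scale1r.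
- rewrite cmulZl cmulZr cmulDl !cmulBr -sE -/r ryC.
  by rewrite addrA subrK subrr !scaler0.
Qed.

End PosNeg.

(** * Extreme functionals *)

Section ExtremeFunctional.
Context (R : realType) (V : lmodType R[i]).
Implicit Types (f g p q : V -> R) (x y z : V) (r t : R).

Definition sublinear p := (forall x y, p (x + y) <= p x + p y) /\
  (forall r x, 0 <= r -> p (r%:C *: x) = r * p x).

Definition real_linear f := (forall x y, f (x + y) = f x + f y) /\
  (forall r x, f (r%:C *: x) = r * f x).

Lemma real_linearN f x : real_linear f -> f (- x) = - f x.
Proof.
move=> lf; rewrite -scaleN1r (_ : -1 = (-1)%:C) ?lf.2 ?mulN1r//.
by rewrite rmorphN1.
Qed.

Definition dominated f p := forall x, f x <= p x.

(* Identifying a sublinear functional with the convex set of the linear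
   functionals that it dominates, [q] defines a face of the set of [p]. *)
Definition face p q := [/\ sublinear q, dominated q p &
  forall t f g, 0 < t < 1 -> real_linear f -> real_linear g ->
    dominated f p -> dominated g p ->
    (forall x, t * f x + (1 - t) * g x <= q x) -> dominated f q].

Lemma sublinear0 p : sublinear p -> p 0 = 0.
Proof. by move=> [_ pZ]; rewrite -(scaler0 V (0%:C)) pZ// mul0r. Qed.

Lemma sublinearN p x : sublinear p -> - p (- x) <= p x.
Proof.
by move=> sp; rewrite lerNl -subr_ge0 opprK -(sublinear0 sp) -(addNr x) sp.1.
Qed.

Lemma face_refl p : sublinear p -> face p p.
Proof. by move=> sp; split=> // x. Qed.

Lemma face_trans q p p' : face p q -> face q p' -> face p p'.
Proof.
move=> [_ qp fq] [sp' p'q fp']; split=> //.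
  by move=> x; exact: le_trans (qp x).
move=> t f g t01 lf lg fp gp fgp'.
have fgq x : t * f x + (1 - t) * g x <= q x by exact: le_trans (p'q x).
have [t0 t1] := andP t01.
apply: (fp' t f g) => //; first exact: (fq t f g).
(* The face condition concludes about the first functional only; exchanging the two, and t with 1 -
   t, covers the other one. *)
apply: (fq (1 - t) g f) => //; first by rewrite subr_gt0 t1 gtrDl oppr_lt0.
by move=> x; rewrite subKr addrC.
Qed.

Let tilt_set q x y :=
  [set s | exists2 t, 0 <= t & s = q (y + t%:C *: x) - t * q x].

(** The support function of the face of [q] where [x] is maximal: if f is linear, below q and f x =
    q x, then f y = f (y + t x) - t q x <= q (y + t x) - t q x for all t >= 0. *)
Definition tilt q x y := inf (tilt_set q x y).

Let tilt_has_inf q x y : sublinear q -> has_inf (tilt_set q x y).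
Proof.
move=> sq; split; first by exists (q (y + 0%:C *: x) - 0 * q x); exists 0.
exists (- q (- y)) => _ [t t0 ->].
rewrite -sq.2// lerBrDr -lerBrDl opprK.
by rewrite (le_trans _ (sq.1 _ _))// addrAC subrr add0r.
Qed.

Lemma tilt_le q x y t : sublinear q -> 0 <= t ->
  tilt q x y <= q (y + t%:C *: x) - t * q x.
Proof. by move=> sq t0; apply: ge_inf; [case: (tilt_has_inf x y sq)|exists t]. Qed.

Lemma le_tilt q x y s : sublinear q ->
  (forall t, 0 <= t -> s <= q (y + t%:C *: x) - t * q x) -> s <= tilt q x y.
Proof.
move=> sq h; apply: lb_le_inf; first by case: (tilt_has_inf x y sq).
by move=> _ [t t0 ->]; exact: h.
Qed.

Lemma tilt_dominated q x : sublinear q -> dominated (tilt q x) q.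
Proof.
move=> sq y; have := tilt_le x y sq (lexx 0).
by rewrite mul0r subr0 scale0r addr0.
Qed.

(** This forces a linear functional below the tilt to take the value [q x] at [x]. *)
Lemma tilt_opp q x : sublinear q -> tilt q x (- x) <= - q x.
Proof.
move=> sq; have := tilt_le x (- x) sq ler01.
by rewrite scale1r addNr (sublinear0 sq) mul1r sub0r.
Qed.

Lemma sublinear_tilt q x : sublinear q -> sublinear (tilt q x).
Proof.
move=> sq; split=> [y z|r y].
  rewrite -lerBlDr; apply: le_tilt => // t t0.
  rewrite lerBlDr -lerBlDl; apply: le_tilt => // s s0.
  rewrite lerBlDr (le_trans (tilt_le _ _ sq (addr_ge0 t0 s0)))//.
  rewrite rmorphD scalerDl addrACA mulrDl.
  by have := sq.1 (y + t%:C *: x) (z + s%:C *: x); lra.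
rewrite le_eqVlt => /orP[/eqP<-|r0].
  rewrite scale0r mul0r; apply/eqP; rewrite eq_le; apply/andP; split.
    have := tilt_le x 0 sq (lexx 0).
    by rewrite scale0r addr0 mul0r subr0 (sublinear0 sq).
  by apply: le_tilt => // t t0; rewrite add0r sq.2// subrr.
apply/eqP; rewrite eq_le; apply/andP; split.
  rewrite -ler_pdivrMl//; apply: le_tilt => // t t0.
  rewrite ler_pdivrMl// mulrBr -(sq.2 r) ?(ltW r0)// mulrA scalerDr scalerA.
  by rewrite -rmorphM; apply: tilt_le => //; rewrite mulr_ge0// ltW.
apply: le_tilt => // t t0.
have tr0 : 0 <= r^-1 * t by rewrite mulr_ge0// invr_ge0 ltW.
have := tilt_le x y sq tr0; rewrite -(ler_pM2l r0) => /le_trans; apply.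
rewrite mulrBr -(sq.2 r) ?(ltW r0)// scalerDr scalerA -rmorphM !mulrA.
by rewrite mulfV ?gt_eqF// mul1r.
Qed.

Lemma face_tilt p q x : face p q -> face p (tilt q x).
Proof.
move=> [sq qp fq]; split; first exact: sublinear_tilt.
  by move=> y; apply: le_trans (qp y); exact: tilt_dominated.
move=> t f g /[dup] t01 /andP[t0 t1] lf lg fp gp fgq y.
have fgq' z : t * f z + (1 - t) * g z <= q z.
  by apply: le_trans (fgq z) _; exact: tilt_dominated.
have hf : dominated f q by exact: (fq t f g).
have hg : dominated g q.
  apply: (fq (1 - t) g f) => //; first by rewrite subr_gt0 t1 gtrDl oppr_lt0.
  by move=> z; rewrite subKr addrC.
(* The combination is at most - q x at - x, hence at least q x at x, where neither [f] nor [g]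
   exceeds q x: both reach it. *)
have fx : f x = q x.
  have := le_trans (fgq (- x)) (tilt_opp x sq).
  rewrite !real_linearN//; have := hf x; have := hg x; nra.
apply: le_tilt => // s s0.
by rewrite -fx lerBrDr -lf.2 -lf.1.
Qed.

Lemma ex_minimal_face p : sublinear p -> exists2 q, face p q &
  forall q', face p q' -> dominated q' q -> q' = q.
Proof.
move=> sp; pose T := {q | face p q}.
(* The order is reversed: the maximal elements of Zorn's lemma are minimal faces. *)
pose le (q1 q2 : T) := `[< dominated (sval q2) (sval q1) >].
have [||||[q fq] qmin] := @Zorn T le.
- by move=> q; apply/asboolP => x.
- move=> q1 q2 q3 /asboolP h1 /asboolP h2; apply/asboolP => x.
  exact: le_trans (h2 x) (h1 x).
- move=> [q1 f1] [q2 f2] /asboolP h1 /asboolP h2; apply/eq_exist/funext => x.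
  by apply/eqP; rewrite eq_le (h1 x) (h2 x).
- move=> C Ctot; have [[q0 Cq0]|C0] := pselect (exists q : T, C q); last first.
    exists (exist _ p (face_refl sp)) => q Cq; exfalso; apply: C0.
    by exists q.
  pose S x := [set s | exists2 q : T, C q & s = sval q x].
  have S_inf x : has_inf (S x).
    split; first by exists (sval q0 x); exists q0.
    exists (- p (- x)) => _ [[q [sq qp ?]] _ ->] /=.
    by apply: le_trans (sublinearN x sq); rewrite lerN2.
  pose q x := inf (S x).
  have q_le (q' : T) x : C q' -> q x <= sval q' x.
    by move=> Cq'; apply: ge_inf; [case: (S_inf x)|exists q'].
  have le_q x s : (forall q' : T, C q' -> s <= sval q' x) -> s <= q x.
    move=> h; apply: lb_le_inf; first by case: (S_inf x).
    by move=> _ [q' Cq' ->]; exact: h.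
  have sq : sublinear q.
    split=> [x y|r x].
      rewrite -lerBlDr; apply: (le_q) => q1 C1.
      rewrite lerBlDr -lerBlDl; apply: (le_q) => q2 C2; rewrite lerBlDr.
      have [[s1 _] _ _] := svalP q1; have [[s2 _] _ _] := svalP q2.
      (* Subadditivity of an infimum needs the chain: the smaller of [q1] and [q2] bounds the value
         at x + y, and both of its terms. *)
      have [/asboolP h|/asboolP h] := Ctot _ _ C1 C2.
        apply: le_trans (q_le _ _ C2) _; apply: le_trans (s2 _ _) _.
        by rewrite addrC lerD.
      apply: le_trans (q_le _ _ C1) _; apply: le_trans (s1 _ _) _.
      by rewrite addrC lerD.
    rewrite le_eqVlt => /orP[/eqP<-|r0].
      rewrite mul0r scale0r; apply/eqP; rewrite eq_le; apply/andP; split.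
        have [s0 _ _] := svalP q0; rewrite -(sublinear0 s0); exact: q_le.
      by apply: (le_q) => q' _; have [s' _ _] := svalP q'; rewrite (sublinear0 s').
    apply/eqP; rewrite eq_le; apply/andP; split.
      rewrite -ler_pdivrMl//; apply: (le_q) => q' C'.
      have [s' _ _] := svalP q'; rewrite ler_pdivrMl// -s'.2 ?(ltW r0)//.
      exact: q_le.
    apply: (le_q) => q' C'; have [s' _ _] := svalP q'.
    by rewrite s'.2 ?(ltW r0)// ler_pM2l//; exact: q_le.
  have fq : face p q.
    split=> //.
      move=> x; apply: le_trans (q_le _ _ Cq0) _.
      by have [_ h _] := svalP q0; exact: h.
    move=> t f g t01 lf lg fp gp fgq x; apply: (le_q) => q' C'.
    have [_ _ h] := svalP q'; apply: (h t f g) => // y.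
    exact: le_trans (fgq y) (q_le _ _ C').
  by exists (exist _ q fq) => q' Cq'; apply/asboolP => x; exact: q_le.
exists q => // q' fq' q'q.
by have := qmin (exist _ q' fq') (asboolT q'q) => -[].
Qed.

(** A minimal face coincides with all of its tilts, so q (- y) <= - q y for every y, and [q] is
    linear: the face is a single point. Searching below [tilt p x] fixes the value at [x]. *)
Theorem ex_extreme_functional p x : sublinear p -> exists f,
  [/\ real_linear f, dominated f p, f x = p x &
    forall t g h, 0 < t < 1 -> real_linear g -> real_linear h ->
      dominated g p -> dominated h p ->
      (forall y, t * g y + (1 - t) * h y = f y) -> g = f].
Proof.
move=> sp; have [q fq qmin] := ex_minimal_face (sublinear_tilt x sp).
have fpq : face p q by apply: face_trans fq; exact/face_tilt/face_refl.
have [sq qp qext] := fpq; have [_ qt _] := fq.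
have qN y : q (- y) = - q y.
  have tq : tilt q y = q by apply: qmin; [exact: face_tilt|exact: tilt_dominated].
  apply/eqP; rewrite eq_le -{1}tq (tilt_opp y sq)/=.
  by have := sublinearN (- y) sq; rewrite opprK.
have lq : real_linear q.
  split=> [y z|r y].
    apply/eqP; rewrite eq_le sq.1/= -lerBrDr.
    by rewrite -qN -{1}(addrK z y) sq.1.
  have [r0|/ltW r0] := leP 0 r; first exact: sq.2.
  rewrite -{1}[r]opprK rmorphN scaleNr qN sq.2 ?oppr_ge0//.
  by rewrite mulNr opprK.
exists q; split=> //.
  apply/eqP; rewrite eq_le qp/= -lerN2 -qN.
  by apply: le_trans (qt _) _; exact: tilt_opp.
move=> t g h t01 lg lh gp hp gh.
have gq : dominated g q by apply: (qext t g h) => // y; rewrite gh.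
apply/funext => y; apply/eqP; rewrite eq_le gq/= -lerN2 -qN.
by rewrite -real_linearN.
Qed.

End ExtremeFunctional.

(** * Hilbert spaces *)

Section RealNorm.
Context (R : realType) (V : normedModType R[i]).
Implicit Types (u v : V) (c : R[i]) (r : R).

Definition rnorm u : R := complex.Re `|u|.

Lemma rnormE u : `|u| = (rnorm u)%:C.
Proof. by rewrite /rnorm RRe_real// normr_real. Qed.

Lemma rnorm_ge0 u : 0 <= rnorm u.
Proof. by rewrite -lecR -rnormE; exact: normr_ge0. Qed.

Lemma ler_rnormD u v : rnorm (u + v) <= rnorm u + rnorm v.
Proof. by have := ler_normD u v; rewrite !rnormE -rmorphD lecR. Qed.

Lemma rnormN u : rnorm (- u) = rnorm u.
Proof. by rewrite /rnorm normrN. Qed.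

Lemma rnormZ r u : rnorm (r%:C *: u) = `|r| * rnorm u.
Proof.
have := normrZ r%:C u; rewrite normc_def/= expr0n addr0 sqrtr_sqr !rnormE.
by rewrite -rmorphM => /complexI.
Qed.

Lemma rnormZi u : rnorm ('i *: u) = rnorm u.
Proof.
have := normrZ 'i u; rewrite normc_def/= expr0n add0r expr1n sqrtr1 !rnormE.
by rewrite mul1r => /complexI.
Qed.

Lemma rnorm0_eq0 u : rnorm u = 0 -> u = 0.
Proof. by move=> u0; apply/eqP; rewrite -normr_eq0 rnormE u0. Qed.

End RealNorm.

(** [T] vanishes at the integers, so its bound on [0, 1] holds everywhere, and a bounded additive
    map is zero. It stands in for continuity in [redotZl]. *)
Lemma additive_bounded_eq0 (R : realType) (T : R -> R) (M t : R) :
  (forall x y, T (x + y) = T x + T y) -> T 1 = 0 ->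
  (forall s, 0 <= s <= 1 -> `|T s| <= M) -> T t = 0.
Proof.
move=> TD T1 TM.
have T0 : T 0 = 0 by apply: (addrI (T 0)); rewrite -TD !addr0.
have TN x : T (- x) = - T x.
  by apply/eqP; rewrite -addr_eq0 -TD addNr T0.
have Tn n x : T (n%:R * x) = n%:R * T x.
  elim: n => [|n ih]; first by rewrite !mul0r T0.
  by rewrite -natr1 !mulrDl !mul1r TD ih.
have Tz (z : int) : T z%:~R = 0.
  case: z => n; first by rewrite -pmulrn -[_%:R]mulr1 Tn T1 mulr0.
  by rewrite NegzE mulrNz TN -pmulrn -[_%:R]mulr1 Tn T1 mulr0 oppr0.
have TM' x : `|T x| <= M.
  have -> : T x = T (x - (Num.floor x)%:~R) by rewrite TD TN Tz subr0.
  apply: TM; rewrite subr_ge0 floor_le//= lerBlDl.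
  by have := ltW (floorD1_gt x); rewrite intrD.
apply/eqP; rewrite -normr_eq0; apply/negP => /negP Tt0.
have Tp : 0 < `|T t| by rewrite lt_def Tt0 normr_ge0.
have M1 : 0 < M + 1 by rewrite ltr_pwDr// (le_trans _ (TM' t)).
have [n _ /(_ n (leqnn n))/= hn] :=
  near_infty_natSinv_lt (PosNum (divr_gt0 Tp M1)).
have := TM' (n.+1%:R * t); rewrite Tn normrM ger0_norm// leNgt => /negP; apply.
move: hn; rewrite ltr_pdivlMr// -ltr_pdivlMl ?invr_gt0// invrK.
by apply: le_lt_trans; rewrite lerDl.
Qed.

(** * The Jordan-von Neumann inner product of a norm *)

Section JordanVonNeumann.
Context (R : realType) (V : normedModType R[i]).
Hypothesis parallelogram : forall u v : V,
  rnorm (u + v) ^+ 2 + rnorm (u - v) ^+ 2 = 2 * (rnorm u ^+ 2 + rnorm v ^+ 2).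
Implicit Types (u v w : V).

Definition redot u v : R := (rnorm (u + v) ^+ 2 - rnorm (u - v) ^+ 2) / 4.

Lemma rnorm0 : rnorm (0 : V) = 0.
Proof. by rewrite /rnorm normr0. Qed.

Lemma redotC u v : redot u v = redot v u.
Proof. by rewrite /redot (addrC u v) -(opprB v u) rnormN. Qed.

Lemma redot_norm u : redot u u = rnorm u ^+ 2.
Proof.
rewrite /redot subrr rnorm0 -mulr2n -scaler_nat -(rmorph_nat (real_complex R)).
by rewrite rnormZ ger0_norm//; field.
Qed.

Lemma redotNl u v : redot (- u) v = - redot u v.
Proof.
by rewrite /redot -(rnormN (- u + v)) -(rnormN (- u - v)) !opprD !opprK; field.
Qed.

(** The parallelogram law yields x.z + y.z = (x + y).(2 z) / 2; the case y = 0 then removes the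
    doubling. *)
Lemma redotDl u v w : redot (u + v) w = redot u w + redot v w.
Proof.
have h2 x y z : redot x z + redot y z = redot (x + y) (z + z) / 2.
  have := parallelogram (x + z) (y + z); have := parallelogram (x - z) (y - z).
  rewrite (addrACA x z y z) (addrACA x (- z) y (- z)) -opprD.
  rewrite (_ : x - z - (y - z) = x - y); last by rewrite opprB addrA subrK.
  rewrite (_ : x + z - (y + z) = x - y); last by rewrite opprD addrACA subrr addr0.
  rewrite /redot; lra.
have h0 x : redot 0 x = 0 by rewrite /redot add0r sub0r rnormN subrr mul0r.
have := h2 u v w; have := h2 (u + v) 0 w; rewrite h0 !addr0.
by move=> -> ->.
Qed.

(** The defect of homogeneity is additive in [r], zero at 1 and bounded for r in [0, 1]. *)
Lemma redotZl (r : R) u v : redot (r%:C *: u) v = r * redot u v.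
Proof.
apply/eqP; rewrite -subr_eq0; apply/eqP.
apply: (@additive_bounded_eq0 _ (fun r => redot (r%:C *: u) v - r * redot u v)
  ((rnorm u + rnorm v) ^+ 2 + `|redot u v|)).
- by move=> x y; rewrite rmorphD scalerDl redotDl; ring.
- by rewrite scale1r mul1r subrr.
- move=> s /andP[s0 s1].
  rewrite (le_trans (ler_normB _ _))// lerD//; last first.
    by rewrite normrM ler_piMl// ger0_norm.
  have sN : rnorm (s%:C *: u) <= rnorm u.
    by rewrite rnormZ ger0_norm// ler_piMl// rnorm_ge0.
  have ha := ler_rnormD (s%:C *: u) v.
  have hb := ler_rnormD (s%:C *: u) (- v).
  rewrite rnormN in hb; rewrite /redot.
  have p0 := rnorm_ge0 u; have q0 := rnorm_ge0 v.
  have a0 := rnorm_ge0 (s%:C *: u + v); have b0 := rnorm_ge0 (s%:C *: u - v).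
  set a := rnorm (_ + v) in ha a0 *; set b := rnorm (_ - v) in hb b0 *.
  set p := rnorm u in sN p0 *; set q := rnorm v in ha hb q0 *.
  have a2 : a ^+ 2 <= (p + q) ^+ 2.
    by rewrite ler_pXn2r ?nnegrE ?addr_ge0// (le_trans ha)// lerD2r.
  have b2 : b ^+ 2 <= (p + q) ^+ 2.
    by rewrite ler_pXn2r ?nnegrE ?addr_ge0// (le_trans hb)// lerD2r.
  have := exprn_ge0 2 a0; have := exprn_ge0 2 b0.
  by move=> ? ?; rewrite ler_norml; apply/andP; split; lra.
Qed.

Lemma redotii u v : redot ('i *: u) ('i *: v) = redot u v.
Proof. by rewrite /redot -scalerDr -scalerBr !rnormZi. Qed.

Lemma redoti u v : redot u ('i *: v) = - redot ('i *: u) v.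
Proof.
rewrite -redotNl -(redotii (- _)) scalerN scalerA -expr2 sqr_i scaleN1r opprK.
by [].
Qed.

(** For a form that is conjugate-linear on the right, the imaginary part at v is the real part at i
    v. *)
Definition jvn_dot u v : R[i] := redot u v +i* redot u ('i *: v).

Lemma jvn_dot_herm u v : jvn_dot u v = conjc (jvn_dot v u).
Proof.
rewrite /jvn_dot/= redotC; congr (_ +i* _).
by rewrite redoti redotC.
Qed.

Lemma jvn_dotDl u v w : jvn_dot (u + v) w = jvn_dot u w + jvn_dot v w.
Proof. by rewrite /jvn_dot !redotDl. Qed.

Lemma jvn_dotZl (c : R[i]) u v : jvn_dot (c *: u) v = c * jvn_dot u v.
Proof.
have -> : c *: u = (complex.Re c)%:C *: u + (complex.Im c)%:C *: ('i *: u).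
  by rewrite scalerA -scalerDl mulrC -complexE.
rewrite jvn_dotDl /jvn_dot !redotZl redotii.
have -> : redot ('i *: u) v = - redot u ('i *: v) by rewrite redoti opprK.
by case: c => a b; apply/eqP; rewrite eq_complex/=; apply/andP; split;
  apply/eqP; ring.
Qed.

Lemma jvn_dot_norm u : jvn_dot u u = `|u| ^+ 2.
Proof.
rewrite rnormE -rmorphXn -redot_norm /jvn_dot.
suff -> : redot u ('i *: u) = 0 by [].
have := redoti u u; have := redotC u ('i *: u); lra.
Qed.

End JordanVonNeumann.

Section HilbertSpace.
Context (R : realType) (H : hilbertType R[i]).
Implicit Types (u v w x y z : H) (c : R[i]).

Lemma hdotC u v : hdot u v = conjc (hdot v u).
Proof. by rewrite hermitian_subproof expr0 mul1r. Qed.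

Let conjcM (x y : R[i]) : conjc (x * y) = conjc x * conjc y.
Proof. exact: rmorphM. Qed.

Lemma hdotBl u v w : hdot (u - v) w = hdot u w - hdot v w.
Proof. exact: linearBl. Qed.

Lemma hdotBr u v w : hdot u (v - w) = hdot u v - hdot u w.
Proof. exact: linearBr. Qed.

Lemma hdotDl u v w : hdot (u + v) w = hdot u w + hdot v w.
Proof. exact: linearDl. Qed.

Lemma hdotDr u v w : hdot u (v + w) = hdot u v + hdot u w.
Proof. exact: linearDr. Qed.

Lemma hdotZl c u v : hdot (c *: u) v = c * hdot u v.
Proof. exact: linearZl_LR. Qed.

Lemma hdotZr c u v : hdot u (c *: v) = conjc c * hdot u v.
Proof. exact: linearZr_LR. Qed.

Lemma hdot0r v : hdot v 0 = 0.
Proof. exact: linear0r. Qed.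

Lemma hdot_eq0 u : hdot u u = 0 -> u = 0.
Proof. by rewrite hdot_norm => /eqP; rewrite sqrf_eq0 normr_eq0 => /eqP. Qed.

Lemma rnorm_hdot u : (rnorm u ^+ 2)%:C = hdot u u.
Proof. by rewrite hdot_norm rnormE rmorphXn. Qed.

Lemma hilbert_parallelogram u v :
  rnorm (u + v) ^+ 2 + rnorm (u - v) ^+ 2 = 2 * (rnorm u ^+ 2 + rnorm v ^+ 2).
Proof.
apply: complexI; rewrite rmorphM !rmorphD /= !rnorm_hdot.
by rewrite !(hdotBl, hdotBr, hdotDl, hdotDr) rmorph1; ring.
Qed.

Lemma subspaceD (W : set H) u v : closed_subspace W -> W u -> W v -> W (u + v).
Proof. by move=> [_ _ WD] Wu Wv; rewrite -[u]scale1r; exact: WD. Qed.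

Lemma subspaceZ (W : set H) c u : closed_subspace W -> W u -> W (c *: u).
Proof. by move=> [_ W0 WD] Wu; rewrite -[_ *: _]addr0; exact: WD. Qed.

Lemma closest_point_orthogonal (W : set H) z x : closed_subspace W -> W x ->
  (forall y, W y -> rnorm z <= rnorm (z - y)) -> hdot z x = 0.
Proof.
move=> Ws Wx zmin; apply/eqP; apply/negP => /negP zx0.
(* Any t > 0 with t |x|^2 < 2 would do: moving z by t <z, x> x lowers |z|^2 by t s (2 - t |x|^2),
   where s = |<z, x>|^2. *)
pose t : R := (rnorm x ^+ 2 + 1)^-1.
have X0 : 0 <= rnorm x ^+ 2 by rewrite exprn_ge0// rnorm_ge0.
have t0 : 0 < t by rewrite invr_gt0 ltr_wpDl.
have tX : t * rnorm x ^+ 2 < 1.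
  by rewrite ltr_pdivrMl ?ltr_wpDl// mulr1 ltrDl.
have [s s0 sE] : exists2 s : R, 0 < s & hdot z x * hdot x z = s%:C.
  apply: gt0_real_complex.
  by rewrite [hdot x z]hdotC -sqr_normc exprn_gt0// normr_gt0.
have := zmin _ (subspaceZ (t%:C * hdot z x) Ws Wx).
rewrite -(@ler_pXn2r _ 2) ?nnegrE ?rnorm_ge0// -lecR !rnorm_hdot.
have -> : hdot (z - (t%:C * hdot z x) *: x) (z - (t%:C * hdot z x) *: x) =
    (rnorm z ^+ 2 - 2 * t * s + t ^+ 2 * s * rnorm x ^+ 2)%:C.
  rewrite hdotBl !hdotBr !hdotZl !hdotZr !conjcM conjc_real -hdotC.
  have -> : hdot z z - t%:C * hdot x z * hdot z x -
      (t%:C * hdot z x * hdot x z -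
       t%:C * hdot z x * (t%:C * hdot x z * hdot x x)) =
      hdot z z - (2 * t)%:C * (hdot z x * hdot x z) +
      (t * t)%:C * (hdot z x * hdot x z) * hdot x x.
    by rewrite !rmorphM /= rmorph_nat; ring.
  rewrite sE -!rnorm_hdot; apply/eqP; rewrite eq_complex/=.
  by apply/andP; split; apply/eqP; ring.
have : 0 < t * s * (2 - t * rnorm x ^+ 2) by rewrite !mulr_gt0//; lra.
rewrite -rnorm_hdot lecR; lra.
Qed.

Theorem ex_orthogonal_projection (W : set H) v : closed_subspace W ->
  exists2 w, W w & forall x, W x -> hdot (v - w) x = 0.
Proof.
move=> Ws; have [Wc W0 _] := Ws.
pose S := [set s | exists2 w, W w & s = rnorm (v - w) ^+ 2].
have S_inf : has_inf S.
  split; first by exists (rnorm (v - 0) ^+ 2); exists 0.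
  by exists 0 => _ [w _ ->]; rewrite exprn_ge0// rnorm_ge0.
pose d := inf S.
have dle w : W w -> d <= rnorm (v - w) ^+ 2.
  by move=> Ww; apply: ge_inf; [case: S_inf|exists w].
have /choice[w_ w_P] (n : nat) :
    exists w, W w /\ rnorm (v - w) ^+ 2 < d + n.+1%:R^-1.
  have [|_ [w Ww ->] wd] := @inf_adherent _ S n.+1%:R^-1 _ S_inf.
    by rewrite invr_gt0.
  by exists w.
have wW n : W (w_ n) by case: (w_P n).
have wd n : rnorm (v - w_ n) ^+ 2 < d + n.+1%:R^-1 by case: (w_P n).
have d0 : 0 <= d.
  by apply: lb_le_inf; [case: S_inf|move=> _ [w _ ->]; rewrite exprn_ge0// rnorm_ge0].
(* The midpoint of [w_ n] and [w_ m] lies in [W], at squared distance at least d from v; the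
   parallelogram law does the rest. *)
have wdist n m : rnorm (w_ n - w_ m) ^+ 2 <= 2 * (n.+1%:R^-1 + m.+1%:R^-1).
  have := hilbert_parallelogram (v - w_ m) (v - w_ n).
  rewrite (_ : v - w_ m - (v - w_ n) = w_ n - w_ m); last first.
    by rewrite opprB addrC addrA subrK.
  have mid : W (2^-1%:C *: (w_ n + w_ m)).
    by apply: subspaceZ => //; exact: subspaceD.
  have -> : v - w_ m + (v - w_ n) = (2%:R)%:C *: (v - 2^-1%:C *: (w_ n + w_ m)).
    rewrite scalerBr scalerA -rmorphM divff ?pnatr_eq0// scale1r rmorph_nat.
    by rewrite scaler_nat mulr2n addrACA -opprD (addrC (w_ m)).
  rewrite rnormZ ger0_norm ?ler0n//.
  have := dle _ mid; have := wd n; have := wd m; rewrite exprMn.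
  by move: (n.+1%:R^-1 : R) (m.+1%:R^-1 : R) => a b; lra.
have wcvg : cvgn w_.
  apply/cauchy_cvgP/cauchy_ballP => e e0; near_simpl.
  have [r r0 ->] := gt0_real_complex e0.
  have r2 : 0 < r ^+ 2 / 4 by rewrite divr_gt0// exprn_gt0.
  have [N _ Nr] := near_infty_natSinv_lt (PosNum r2).
  exists ([set n | N <= n], [set n | N <= n])%N; first by split; exists N.
  move=> [n m] [/= Nn Nm]; rewrite -ball_normE /= rnormE ltcR.
  rewrite -(@ltr_pXn2r _ 2) ?nnegrE ?rnorm_ge0 ?ltW//.
  apply: le_lt_trans (wdist n m) _.
  have := Nr n Nn; have := Nr m Nm => /=.
  by move: (n.+1%:R^-1 : R) (m.+1%:R^-1 : R) => a b; lra.
pose w := limn w_.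
have ww : w_ @ \oo --> w by exact: wcvg.
have Ww : W w by apply: (closed_cvg W Wc _ _ ww); apply: nearW.
have vw : rnorm (v - w) ^+ 2 <= d.
  have cv : (fun n => rnorm (v - w_ n) ^+ 2) @ \oo --> rnorm (v - w) ^+ 2.
    have h : (fun n => rnorm (v - w_ n)) @ \oo --> rnorm (v - w).
      apply/cvgrPdist_le => e e0.
      have eC : 0 < e%:C by rewrite ltcR.
      move/cvgrPdist_le : ww => /(_ _ eC); apply: filterS => n.
      rewrite rnormE lecR => h; rewrite ler_norml; apply/andP; split.
        have := ler_rnormD (v - w) (w - w_ n).
        by rewrite addrA subrK; lra.
      have := ler_rnormD (v - w_ n) (w_ n - w).
      by rewrite addrA subrK -(opprB w (w_ n)) rnormN; lra.
    exact: cvgM.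
  have cd : (fun n => d + n.+1%:R^-1) @ \oo --> d + 0.
    by apply: cvgD; [exact: cvg_cst|exact: cvg_harmonic].
  rewrite addr0 in cd; rewrite -(cvg_lim _ cd)// -(cvg_lim _ cv)//.
  apply: ler_lim; [exact: cvgP cv|exact: cvgP cd|].
  by apply: nearW => n; exact: ltW.
exists w => // x Wx; apply: (closest_point_orthogonal Ws Wx) => y Wy.
rewrite -(@ler_pXn2r _ 2) ?nnegrE ?rnorm_ge0//.
apply: le_trans vw _; rewrite -addrA -opprD; apply: dle.
exact: (subspaceD Ws).
Qed.

End HilbertSpace.

(** * The GNS representation *)

Section GNSSpace.
Context (R : realType) (A : cstarAlgType R[i]).
Implicit Types (a b : A) (c : R[i]) (r t k : R).

(** A positive functional is encoded by its real part, which determines it; invariance under [star]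
    expresses that the functional is hermitian. *)
Record posfun := PosFun {
  posfun_fun :> A -> R;
  posfun_linear : real_linear posfun_fun;
  posfun_star : forall a, posfun_fun (star a) = posfun_fun a;
  posfun_pos : forall a, pos a -> 0 <= posfun_fun a
}.

Definition cabs c : R := complex.Re `|c|.

Lemma cabsE c : `|c| = (cabs c)%:C.
Proof. by rewrite /cabs RRe_real// normr_real. Qed.

Lemma cabs_ge0 c : 0 <= cabs c.
Proof. by rewrite -lecR -cabsE; exact: normr_ge0. Qed.

Lemma conjc_mul c : conjc c * c = (cabs c ^+ 2)%:C.
Proof. by rewrite mulrC -sqr_normc cabsE rmorphXn. Qed.

Lemma cabs_conj c : cabs (conjc c) = cabs c.
Proof. by rewrite /cabs normcJ. Qed.

Lemma cabs_real r : 0 <= r -> cabs r%:C = r.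
Proof. by move=> r0; rewrite /cabs ger0_norm ?lecR. Qed.

Context (f : posfun).

Definition gns_form b := f (star b ** b).
Local Notation D := gns_form.

Lemma gns_form_ge0 b : 0 <= D b.
Proof. exact/posfun_pos/pos_star_cmul. Qed.

Lemma gns_formZ c b : D (c *: b) = cabs c ^+ 2 * D b.
Proof.
rewrite /D starZ cmulZl cmulZr scalerA conjc_mul.
by have [_ ->] := posfun_linear f.
Qed.

Lemma gns_form0 : D 0 = 0.
Proof. by rewrite -(scale0r 0) gns_formZ /cabs normr0 expr0n mul0r. Qed.

Lemma gns_formD a b : D (a + b) = D a + D b + 2 * f (star a ** b).
Proof.
have [fD fZ] := posfun_linear f.
have -> : f (star a ** b) = f (star b ** a).
  by rewrite -posfun_star starM starK.
rewrite /D starD cmulDl !cmulDr !fD.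
have -> : f (star a ** b) = f (star b ** a).
  by rewrite -posfun_star starM starK.
ring.
Qed.

Lemma gns_formB a b : D (a - b) = D a + D b - 2 * f (star a ** b).
Proof.
have lf := posfun_linear f.
rewrite gns_formD cmulNr (real_linearN _ lf) mulrN; congr (_ + _ - _).
by rewrite /D starN cmulNl cmulNr opprK.
Qed.

(* A vector of the GNS space of [f] is represented by the real part of the
   antilinear functional that it induces on [A]; accordingly, [c *: u] is
   [u] precomposed with multiplication by the conjugate of [c].  All bounded
   functionals being allowed, no completion is needed. *)
Record gns := Gns {
  gns_fun :> A -> R;
  gns_linear : real_linear gns_fun;
  gns_bound : exists M, forall b, gns_fun b ^+ 2 <= M * D b
}.

HB.instance Definition _ := gen_eqMixin gns.
HB.instance Definition _ := gen_choiceMixin gns.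

Lemma gns_eq (u v : gns) : u =1 v -> u = v.
Proof.
case: u v => u lu bu [v lv bv]/= /funext uv; subst v.
by rewrite (Prop_irrelevance lu lv) (Prop_irrelevance bu bv).
Qed.

Program Definition gns0 := @Gns (fun=> 0) _ _.
Next Obligation. by split=> *; rewrite ?addr0 ?mulr0. Qed.
Next Obligation. by exists 0 => b; rewrite expr0n mul0r. Qed.

Program Definition gns_opp (u : gns) := @Gns (fun b => - u b) _ _.
Next Obligation.
by move=> u; have [uD uZ] := gns_linear u; split=> *; rewrite ?uD ?uZ ?opprD ?mulrN.
Qed.
Next Obligation.
by move=> u; have [M h] := gns_bound u; exists M => b; rewrite sqrrN. Qed.

Program Definition gns_add (u v : gns) := @Gns (fun b => u b + v b) _ _.
Next Obligation.
move=> u v; have [uD uZ] := gns_linear u; have [vD vZ] := gns_linear v.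
by split=> *; rewrite ?uD ?vD ?uZ ?vZ ?mulrDr// addrACA.
Qed.
Next Obligation.
move=> u v; have [M hM] := gns_bound u; have [N hN] := gns_bound v.
exists (2 * (M + N)) => b; have := hM b; have := hN b.
by have := sqr_ge0 (u b - v b); rewrite !expr2; lra.
Qed.

Program Definition gns_scale c (u : gns) := @Gns (fun b => u (conjc c *: b)) _ _.
Next Obligation.
move=> c u; have [uD uZ] := gns_linear u.
by split=> *; rewrite ?scalerDr ?uD// scalerA mulrC -scalerA uZ.
Qed.
Next Obligation.
move=> c u; have [M h] := gns_bound u; exists (M * cabs c ^+ 2) => b.
by rewrite -mulrA -(cabs_conj c) -gns_formZ.
Qed.

Let addA : associative gns_add.
Proof. by move=> u v w; apply: gns_eq => b /=; rewrite addrA. Qed.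
Let addC : commutative gns_add.
Proof. by move=> u v; apply: gns_eq => b /=; rewrite addrC. Qed.
Let add0 : left_id gns0 gns_add.
Proof. by move=> u; apply: gns_eq => b /=; rewrite add0r. Qed.
Let addN : left_inverse gns0 gns_opp gns_add.
Proof. by move=> u; apply: gns_eq => b /=; rewrite addNr. Qed.

HB.instance Definition _ := GRing.isZmodule.Build gns addA addC add0 addN.

Let scaleA c c' (u : gns) : gns_scale c (gns_scale c' u) = gns_scale (c * c') u.
Proof.
apply: gns_eq => b /=; rewrite scalerA; congr (u (_ *: _)).
by rewrite mulrC [RHS]rmorphM.
Qed.
Let scale1 : left_id 1 gns_scale.
Proof. by move=> u; apply: gns_eq => b /=; rewrite oppr0 scale1r. Qed.
Let scaleDr : right_distributive gns_scale +%R.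
Proof. by move=> c u v; apply: gns_eq. Qed.
Let scaleDl (u : gns) : {morph gns_scale^~ u : c c' / c + c'}.
Proof.
move=> c c'; apply: gns_eq => b /=; rewrite [conjc _]rmorphD scalerDl.
by have [-> _] := gns_linear u.
Qed.

HB.instance Definition _ :=
  GRing.Zmodule_isLmodule.Build R[i] gns scaleA scale1 scaleDr scaleDl.

End GNSSpace.

Section GNSNorm.
Context (R : realType) (A : cstarAlgType R[i]) (f : posfun A).
Implicit Types (a b : A) (c : R[i]) (r t k : R) (u v w : gns f).
Local Notation D := (gns_form f).
Local Notation sq := Num.sqrt.

Definition gns_norm u : R := sup [set s | exists2 b, D b <= 1 & s = u b].

Lemma gns_form_real t b : D (t%:C *: b) = t ^+ 2 * D b.
Proof.
rewrite gns_formZ; congr (_ * _); apply: complexI.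
by rewrite -conjc_mul conjc_real -expr2 rmorphXn.
Qed.

Let norm_has_sup u : has_sup [set s | exists2 b, D b <= 1 & s = u b].
Proof.
split; first by exists (u 0); exists 0; rewrite // gns_form0.
have [M hM] := gns_bound u; exists (sq `|M|) => _ [b Db ->].
rewrite (le_trans (ler_norm _))// -sqrtr_sqr ler_sqrt ?normr_ge0//.
apply: le_trans (hM b) _; apply: le_trans (ler_wpM2r _ (ler_norm M)) _.
  exact: gns_form_ge0.
by rewrite ler_piMr.
Qed.

Lemma gns_abs_le u b : `|u b| <= gns_norm u * sq (D b).
Proof.
have lu := gns_linear u; have [uD uZ] := lu.
(* The form may be degenerate; boundedness makes [u] vanish where it does. *)
have [D0|Dn] := eqVneq (D b) 0.
  have [M /(_ b)] := gns_bound u; rewrite D0 mulr0 sqrtr0 mulr0 => h.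
  suff -> : u b = 0 by rewrite normr0.
  by apply/eqP; rewrite -sqrf_eq0 eq_le h sqr_ge0.
have Dp : 0 < D b by rewrite lt_def Dn gns_form_ge0.
have sp : 0 < sq (D b) by rewrite sqrtr_gt0.
have h t : t ^+ 2 = (D b)^-1 -> t * u b <= gns_norm u.
  move=> tD; rewrite -uZ; apply: sup_ubound; first by case: (norm_has_sup u).
  by exists (t%:C *: b) => //; rewrite gns_form_real tD mulVf.
have e2 : (sq (D b))^-1 ^+ 2 = (D b)^-1 by rewrite exprVn sqr_sqrtr ?ltW.
rewrite ler_norml -lerNl; apply/andP; split.
  have := h (- (sq (D b))^-1); rewrite sqrrN => /(_ e2).
  by rewrite mulNr -mulrN ler_pdivrMl// mulrC.
by have := h _ e2; rewrite ler_pdivrMl// mulrC.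
Qed.

Lemma gns_norm_le u k : 0 <= k -> (forall b, u b <= k * sq (D b)) ->
  gns_norm u <= k.
Proof.
move=> k0 h; apply: ge_sup; first by case: (norm_has_sup u).
move=> _ [b Db ->]; apply: le_trans (h b) _; apply: ler_piMr => //.
by rewrite -sqrtr1 ler_sqrt.
Qed.

Lemma gns_norm_ge0 u : 0 <= gns_norm u.
Proof.
have [u0 _] := gns_linear u.
have <- : u 0 = 0 by apply: (addrI (u 0)); rewrite -u0 !addr0.
apply: sup_ubound; first by case: (norm_has_sup u).
by exists 0; rewrite // gns_form0.
Qed.

Lemma gns_normD u v : gns_norm (u + v) <= gns_norm u + gns_norm v.
Proof.
apply: gns_norm_le => [|b]; first by rewrite addr_ge0// gns_norm_ge0.
rewrite mulrDl; apply: lerD; exact: le_trans (ler_norm _) (gns_abs_le _ _).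
Qed.

Lemma gns_norm_eq0 u : gns_norm u = 0 -> u = 0.
Proof.
move=> u0; apply: gns_eq => b; apply/eqP; rewrite -normr_le0.
by have := gns_abs_le u b; rewrite u0 mul0r.
Qed.

Let sqDZ c b : sq (D (c *: b)) = cabs c * sq (D b).
Proof. by rewrite gns_formZ sqrtrM ?sqr_ge0// sqrtr_sqr ger0_norm ?cabs_ge0. Qed.

Lemma gns_normZ c u : gns_norm (c *: u) = cabs c * gns_norm u.
Proof.
have h c' w : gns_norm (c' *: w) <= cabs c' * gns_norm w.
  apply: gns_norm_le => [|b]; first by rewrite mulr_ge0 ?cabs_ge0 ?gns_norm_ge0.
  apply: le_trans (ler_norm _) _; apply: le_trans (gns_abs_le w _) _.
  by rewrite sqDZ cabs_conj mulrCA mulrA.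
apply/eqP; rewrite eq_le h/=.
have [->|c0] := eqVneq c 0.
  by rewrite /cabs normr0 mul0r gns_norm_ge0.
have cp : 0 < cabs c.
  by rewrite lt_def cabs_ge0 andbT -(inj_eq (@complexI R)) -cabsE normr_eq0.
rewrite -{1}[u]scale1r -(mulVf c0) -scalerA -ler_pdivlMl//.
apply: le_trans (h _ _) _.
suff -> : cabs c^-1 = (cabs c)^-1 by [].
by apply: complexI; rewrite -cabsE fmorphV normfV cabsE.
Qed.

Let normD u v : (gns_norm (u + v))%:C <= (gns_norm u)%:C + (gns_norm v)%:C.
Proof. by rewrite -rmorphD lecR gns_normD. Qed.
Let normZ c u : (gns_norm (c *: u))%:C = `|c| * (gns_norm u)%:C.
Proof. by rewrite gns_normZ rmorphM cabsE. Qed.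
Let norm0 u : (gns_norm u)%:C = 0 -> u = 0.
Proof. by move=> /complexI; exact: gns_norm_eq0. Qed.

HB.instance Definition _ :=
  Lmodule_isNormed.Build R[i] (gns f) normD normZ norm0.

Lemma gns_rnormE u : rnorm u = gns_norm u.
Proof. by []. Qed.

End GNSNorm.

Section GNSHilbert.
Context (R : realType) (A : cstarAlgType R[i]) (f : posfun A).
Implicit Types (a b : A) (c : R[i]) (r t k : R) (u v w : gns f).
Local Notation D := (gns_form f).
Local Notation sq := Num.sqrt.

Let gnsB u v b : (u - v) b = u b - v b. Proof. by []. Qed.

(** The limit is taken pointwise in the reals. The estimate [lest] shows it to be bounded and
    approached in norm. *)
Lemma gns_complete (F : set_system (gns f)) :
  ProperFilter F -> cauchy F -> cvg F.
Proof.
move=> FF /cauchyP Fc.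
have Fex r : 0 < r -> exists x : gns f, F [set u | gns_norm (x - u) < r].
  move=> r0; have [|x] := Fc r%:C; first by rewrite ltcR.
  rewrite -ball_normE /= => Fx; exists x; apply: filterS Fx => u /=.
  by rewrite rnormE ltcR.
have /choice[l lP] b : exists s : R, (fun u : gns f => u b) @ F --> s.
  suff /R_complete/cvg_ex : cauchy ((fun u : gns f => u b) @ F) by [].
  apply: cauchy_exP => e e0.
  have D1 : 0 < sq (D b) + 1 by rewrite ltr_wpDl// sqrtr_ge0.
  have [x Fx] := Fex _ (divr_gt0 e0 D1).
  exists (x b); rewrite -ball_normE /=; apply: filterS Fx => u /= xu.
  rewrite -gnsB; apply: le_lt_trans (gns_abs_le _ _) _.
  apply: (@le_lt_trans _ _ (e / (sq (D b) + 1) * sq (D b))).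
    by rewrite ler_wpM2r ?sqrtr_ge0// ltW.
  by rewrite mulrAC ltr_pdivrMr// ltr_pM2l// ltrDl.
have lest r (x : gns f) b : F [set u | gns_norm (x - u) < r] ->
    `|x b - l b| <= r * sq (D b).
  move=> Fx; apply/ler_addgt0Pr => e e0.
  have Fl : F [set u : gns f | `|l b - u b| <= e].
    by move/cvgrPdist_le : (lP b) => /(_ _ e0).
  have [u [/= xu lu]] := filter_ex (filterI Fx Fl).
  rewrite -(subrK (u b) (x b)) -addrA (le_trans (ler_normD _ _))//.
  rewrite lerD//; last by rewrite distrC.
  rewrite -gnsB (le_trans (gns_abs_le _ _))// ler_wpM2r ?sqrtr_ge0//.
  exact: ltW.
have ll : real_linear l.
  split=> [a b|r b].
    apply: (cvg_unique _ (lP (a + b))); first exact: norm_hausdorff.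
    rewrite (_ : (fun u : gns f => u (a + b)) = (fun u => u a + u b)).
      exact: cvgD.
    by apply/funext => u; have [-> _] := gns_linear u.
  apply: (cvg_unique _ (lP (r%:C *: b))); first exact: norm_hausdorff.
  rewrite (_ : (fun u : gns f => u (r%:C *: b)) = (fun u => r * u b)).
    by apply: cvgM => //; exact: cvg_cst.
  by apply/funext => u; have [_ ->] := gns_linear u.
have lb : exists M, forall b, l b ^+ 2 <= M * D b.
  have [x Fx] := Fex _ ltr01; exists ((gns_norm x + 1) ^+ 2) => b.
  have k0 : 0 <= (gns_norm x + 1) * sq (D b).
    by rewrite mulr_ge0 ?sqrtr_ge0// addr_ge0// gns_norm_ge0.
  rewrite -[D b]sqr_sqrtr ?gns_form_ge0// -exprMn -(real_normK (num_real (l b))).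
  rewrite ler_pXn2r ?nnegrE//.
  rewrite -(subrK (x b) (l b)) (le_trans (ler_normD _ _))// addrC mulrDl.
  by rewrite lerD// ?gns_abs_le// distrC; exact: lest.
apply/cvg_ex; exists (Gns ll lb); apply/cvgrPdist_le => e e0.
have [r r0 ->] := gt0_real_complex e0.
have r2 : 0 < r / 2 by rewrite divr_gt0.
have [x Fx] := Fex _ r2; apply: filterS (Fx) => u /= xu.
rewrite rnormE lecR gns_rnormE -(subrK x (Gns _ _)) -addrA.
rewrite (le_trans (gns_normD _ _))// [r]splitr; apply: lerD; last exact: ltW.
apply: gns_norm_le => [|b]; first exact: ltW.
by rewrite (le_trans (ler_norm _))// distrC; exact: lest.
Qed.

HB.instance Definition _ := Uniform_isComplete.Build (gns f) gns_complete.

(** Together with [gns_quad_sup], it presents the squared norm as the supremum of 2 u b - D b, the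
    Legendre conjugate of the form. Unlike the supremum over the unit ball, this one is suited to
    quadratic identities. *)
Lemma gns_quad_le u b : 2 * u b - D b <= gns_norm u ^+ 2.
Proof.
have := le_trans (ler_norm _) (gns_abs_le u b).
have := sqr_sqrtr (gns_form_ge0 f b); have := gns_norm_ge0 u.
have := sqr_ge0 (gns_norm u - sq (D b)).
rewrite !expr2; lra.
Qed.

Lemma gns_quad_sup u k : (forall b, 2 * u b - D b <= k) -> gns_norm u ^+ 2 <= k.
Proof.
move=> h; have [uD uZ] := gns_linear u.
have u0 : u 0 = 0 by apply: (addrI (u 0)); rewrite -uD !addr0.
have k0 : 0 <= k by have := h 0; rewrite gns_form0 u0 mulr0 subr0.
rewrite -[k]sqr_sqrtr// ler_pXn2r ?nnegrE ?gns_norm_ge0 ?sqrtr_ge0//.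
apply: gns_norm_le => [|b]; first exact: sqrtr_ge0.
rewrite -sqrtrM// (le_trans (ler_norm _))// -sqrtr_sqr.
have kD : 0 <= k * D b by rewrite mulr_ge0// gns_form_ge0.
rewrite ler_sqrt//.
have q t : 2 * t * u b - t ^+ 2 * D b <= k.
  by have := h (t%:C *: b); rewrite gns_form_real uZ mulrA.
have [D0|Dn] := eqVneq (D b) 0.
  (* For nonzero [u b] this multiple of [b] would give 2 (k + 1) <= k. *)
  have := q ((k + 1) / u b); rewrite D0 !mulr0 subr0.
  have [->|ub] := eqVneq (u b) 0; first by rewrite expr0n.
  by rewrite mulrA divfK//; lra.
have Dp : 0 < D b by rewrite lt_def Dn gns_form_ge0.
have := q (u b / D b); rewrite -(ler_pM2r Dp).
rewrite (_ : (_ - _) * D b = u b ^+ 2)//; by field.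
Qed.

(** The terms of u + v at [a] and of u - v at [b] add up to twice those of u at (a + b)/2 and of v
    at (a - b)/2, by the parallelogram law of [D]. *)
Let par_le u v : gns_norm (u + v) ^+ 2 + gns_norm (u - v) ^+ 2 <=
  2 * (gns_norm u ^+ 2 + gns_norm v ^+ 2).
Proof.
rewrite -lerBrDl; apply: gns_quad_sup => b; rewrite lerBrDl -lerBrDr.
apply: gns_quad_sup => a; rewrite lerBrDr.
have [uD _] := gns_linear u; have [vD _] := gns_linear v.
have lu := real_linearN b (gns_linear v).
rewrite -[(u + v) a]/(u a + v a) -[(u - v) b]/(u b - v b).
have hD : D (a + b) + D (a - b) = 2 * (D a + D b).
  by rewrite gns_formD gns_formB; ring.
have := gns_quad_le u (2^-1%:C *: (a + b)).
have := gns_quad_le v (2^-1%:C *: (a - b)).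
have [_ uZ] := gns_linear u; have [_ vZ] := gns_linear v.
rewrite !gns_form_real !uZ !vZ !uD !vD lu.
have -> : (2^-1 : R) ^+ 2 = 4^-1 by rewrite expr2 -invfM -natrM.
lra.
Qed.

Lemma gns_parallelogram u v : rnorm (u + v) ^+ 2 + rnorm (u - v) ^+ 2 =
  2 * (rnorm u ^+ 2 + rnorm v ^+ 2).
Proof.
apply/eqP; rewrite eq_le !gns_rnormE par_le/=.
(* The reverse inequality is the same one for u + v and u - v, whose sum and difference are 2 u and
   2 v. *)
have := par_le (u + v) (u - v).
have -> : u + v + (u - v) = u + u by rewrite addrACA subrr addr0.
have -> : u + v - (u - v) = v + v by rewrite opprB addrCA addrAC subrr add0r.
have h2 w : gns_norm (w + w) ^+ 2 = 4 * gns_norm w ^+ 2.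
  rewrite -mulr2n -scaler_nat gns_normZ -(rmorph_nat (real_complex R)).
  by rewrite cabs_real// exprMn -natrX.
rewrite !h2; lra.
Qed.

End GNSHilbert.

Section GNSVector.
Context (R : realType) (A : cstarAlgType R[i]) (f : posfun A).
Implicit Types (a b : A) (c : R[i]) (r t k : R) (u v w : gns f).
Local Notation D := (gns_form f).

Lemma starZ_real r a : star (r%:C *: a) = r%:C *: star a.
Proof. by rewrite starZ [Num.conj _]conjc_real. Qed.

Let gns_vec_linear a : real_linear (fun b => f (star b ** a)).
Proof.
have [fD fZ] := posfun_linear f.
split=> [x y|r x]; first by rewrite starD cmulDl fD.
by rewrite starZ_real cmulZl fZ.
Qed.

Lemma posfun_CS a b : f (star b ** a) ^+ 2 <= D a * D b.
Proof.
have [D0|Dn] := eqVneq (D b) 0.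
  have h t : 0 <= 2 * t * f (star b ** a) + D a.
    have := gns_form_ge0 f (t%:C *: b + a).
    rewrite gns_formD gns_form_real D0 mulr0 add0r.
    have [_ fZ] := posfun_linear f.
    by rewrite starZ_real cmulZl fZ; lra.
  have := h (- (D a + 1) / f (star b ** a)).
  have [->|q0] := eqVneq (f (star b ** a)) 0.
    by rewrite expr0n D0 [D a * 0]mulr0.
  rewrite (_ : 2 * _ * _ = - 2 * (D a + 1)); last by field.
  by have := gns_form_ge0 f a; lra.
have Dp : 0 < D b by rewrite lt_def Dn gns_form_ge0.
have := gns_form_ge0 f ((- f (star b ** a) / D b)%:C *: b + a).
rewrite gns_formD gns_form_real; have [_ fZ] := posfun_linear f.
rewrite starZ_real cmulZl fZ -(pmulr_rge0 _ Dp).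
rewrite (_ : D b * _ = D a * D b - f (star b ** a) ^+ 2); last by field.
by rewrite subr_ge0.
Qed.

Definition gns_vec a : gns f :=
  @Gns R A f (fun b => f (star b ** a)) (gns_vec_linear a)
    (ex_intro _ (D a) (posfun_CS a)).

Lemma gns_vecZ c a : gns_vec (c *: a) = c *: gns_vec a.
Proof.
apply: gns_eq => b; rewrite /= -[RHS]/(gns_vec a (conjc c *: b))/=.
by rewrite starZ cmulZl cmulZr [Num.conj _]conjcK.
Qed.

Lemma gns_vecN a : gns_vec (- a) = - gns_vec a.
Proof. by rewrite -scaleN1r gns_vecZ scaleN1r. Qed.

(** Translating [b] by [a] in the supremum of 2 u b - D b completes the square; each inequality uses
    one direction. The reproducing property [redot_vec] follows. *)
Lemma gns_norm_add_vec u a :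
  gns_norm (u + gns_vec a) ^+ 2 = gns_norm u ^+ 2 + 2 * u a + D a.
Proof.
have [uD uZ] := gns_linear u; have lu := real_linearN _ (gns_linear u).
have fC x y : f (star x ** y) = f (star y ** x).
  by rewrite -posfun_star starM starK.
have addE x : (u + gns_vec a) x = u x + f (star x ** a) by [].
apply/eqP; rewrite eq_le; apply/andP; split.
  apply: gns_quad_sup => b; rewrite addE.
  have := gns_quad_le u (b - a); rewrite uD lu gns_formB (fC b a); lra.
rewrite -addrA -lerBrDr; apply: gns_quad_sup => b.
have := gns_quad_le (u + gns_vec a) (b + a).
rewrite addE uD gns_formD starD cmulDl.
have [-> _] := posfun_linear f; rewrite -/(D a); lra.
Qed.

Lemma redot_vec u a : redot u (gns_vec a) = u a.
Proof.
have lu := real_linearN a (gns_linear u).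
rewrite /redot !gns_rnormE -gns_vecN !gns_norm_add_vec lu.
have -> : D (- a) = D a by rewrite -scaleN1r gns_formZ /cabs normrN1 expr1n mul1r.
by field.
Qed.

(** If every |u - a|^2 exceeded r, then 2 u b - D b would stay below |u|^2 - r, against its supremum
    |u|^2. *)
Lemma gns_vec_dense u r : 0 < r -> exists a, gns_norm (u - gns_vec a) ^+ 2 <= r.
Proof.
move=> r0; apply: contrapT => h.
suff : gns_norm u ^+ 2 <= gns_norm u ^+ 2 - r by lra.
apply: gns_quad_sup => b; rewrite leNgt; apply/negP => hb; apply: h; exists b.
have lu := real_linearN b (gns_linear u).
rewrite -gns_vecN gns_norm_add_vec lu.
have -> : D (- b) = D b by rewrite -scaleN1r gns_formZ /cabs normrN1 expr1n mul1r.
lra.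
Qed.

Let par := @gns_parallelogram R A f.

Lemma gns_norm_sub u v :
  gns_norm (u - v) ^+ 2 = gns_norm u ^+ 2 + gns_norm v ^+ 2 - 2 * redot u v.
Proof. by have := par u v; rewrite /redot !gns_rnormE; lra. Qed.

Lemma redot_CS u v : redot u v ^+ 2 <= gns_norm u ^+ 2 * gns_norm v ^+ 2.
Proof.
have h t : 0 <= gns_norm u ^+ 2 + t ^+ 2 * gns_norm v ^+ 2 - 2 * t * redot u v.
  have := sqr_ge0 (gns_norm (u - t%:C *: v)); rewrite gns_norm_sub.
  rewrite -(gns_rnormE (_ *: v)) rnormZ exprMn real_normK ?num_real// gns_rnormE.
  by rewrite (redotC u) (redotZl par) (redotC v u) mulrA.
have [v0|vn] := eqVneq (gns_norm v) 0.
  have -> : v = 0 by exact: gns_norm_eq0.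
  have -> : redot u 0 = 0 by rewrite /redot addr0 subr0 subrr mul0r.
  by rewrite expr0n mulr_ge0 ?sqr_ge0.
have vp : 0 < gns_norm v ^+ 2 by rewrite exprn_gt0// lt_def vn gns_norm_ge0.
have := h (redot u v / gns_norm v ^+ 2); rewrite -(pmulr_rge0 _ vp).
rewrite (_ : gns_norm v ^+ 2 * _ =
  gns_norm u ^+ 2 * gns_norm v ^+ 2 - redot u v ^+ 2); last by field.
by rewrite subr_ge0.
Qed.

End GNSVector.

Lemma bounded_linear_continuous_rnorm (R : realType) (V W : normedModType R[i])
  (g : {linear V -> W}) (k : R) :
  (forall v, rnorm (g v) <= k * rnorm v) -> continuous g.
Proof.
move=> gk u; apply/cvgrPdist_le => e e0.
have [r r0 ->] := gt0_real_complex e0.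
have k1 : 0 < `|k| + 1 by rewrite ltr_wpDl.
apply/nbhs_ballP; exists (r / (`|k| + 1))%:C; first by rewrite /= ltcR divr_gt0.
move=> v; rewrite -ball_normE /= rnormE ltcR => /ltW.
rewrite ler_pdivlMr// mulrC => h.
rewrite -linearB rnormE lecR (le_trans (gk _))// (le_trans _ h)//.
rewrite ler_wpM2r ?rnorm_ge0// (le_trans (ler_norm _))//.
by rewrite lerDl.
Qed.

Section GNSRep.
Context (R : realType) (A : cstarAlgType R[i]) (f : posfun A).
Implicit Types (a b : A) (c : R[i]) (r t k : R) (u v w : gns f).
Local Notation D := (gns_form f).

Let par := @gns_parallelogram R A f.

Definition gns_dot u v : R[i] := jvn_dot u v.

Let gns_dotC u v : gns_dot u v = Num.conj (gns_dot v u).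
Proof. by rewrite [LHS]jvn_dot_herm. Qed.

Let gns_dot_linearl v : linear_for *%R (gns_dot ^~ v).
Proof. by move=> c u w; rewrite /gns_dot (jvn_dotDl par) (jvn_dotZl par). Qed.

Let gns_dot_linearr u : linear_for (@Num.conj R[i] \; *%R) (gns_dot u).
Proof.
move=> c v w; rewrite gns_dotC gns_dot_linearl rmorphD rmorphM.
by congr (_ * _ + _); rewrite [RHS]gns_dotC.
Qed.

HB.instance Definition _ := bilinear_isBilinear.Build R[i] (gns f) (gns f) R[i]
  *%R (@Num.conj R[i] \; *%R) gns_dot (gns_dot_linearl, gns_dot_linearr).

Let gns_dot_hermitian u v : gns_dot u v = (-1) ^+ false * Num.conj (gns_dot v u).
Proof. by rewrite expr0 mul1r gns_dotC. Qed.

HB.instance Definition _ := isHermitianSesquilinear.Build R[i] (gns f) false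
  (@Num.conj R[i]) gns_dot gns_dot_hermitian.

Let gns_dot_gt0 u : u != 0 -> 0 < gns_dot u u.
Proof. by move=> u0; rewrite /gns_dot jvn_dot_norm exprn_gt0// normr_gt0. Qed.

HB.instance Definition _ := isDotProduct.Build R[i] (gns f) gns_dot gns_dot_gt0.

Let gns_dot_norm u : gns_dot u u = `|u| ^+ 2.
Proof. exact: jvn_dot_norm. Qed.

HB.instance Definition _ := isHilbert.Build R[i] (gns f) gns_dot_norm.


Lemma rnorm_star a : rnorm (star a) = rnorm a.
Proof. by rewrite /rnorm star_norm. Qed.

(** Conjugating |a|^2 - a^* a >= 0 by [b]; this makes the left multiplications bounded. *)
Lemma gns_form_cmul a b : D (a ** b) <= rnorm a ^+ 2 * D b.
Proof.
pose t := `|star a| ^+ 2.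
have pt : pos (t *: cone - star a ** a).
  apply: pos_scalar_sub; first exact: pos_star_cmul.
  by rewrite cstar_identity /t star_norm.
have := posfun_pos f (pos_conj b pt).
have -> : star b ** (t *: cone - star a ** a) ** b =
    t *: (star b ** b) - star (a ** b) ** (a ** b).
  by rewrite starM cmulBr cmulBl cmulZr cmula1 cmulZl !cmulA.
have tE : t = (rnorm a ^+ 2)%:C by rewrite /t star_norm rnormE -rmorphXn.
have [fD fZ] := posfun_linear f.
by rewrite fD (real_linearN _ (posfun_linear f)) tE fZ subr_ge0.
Qed.

Let gnsL_linear a u : real_linear (fun b => u (star a ** b)).
Proof.
have [uD uZ] := gns_linear u.
by split=> *; rewrite ?cmulDr ?uD// cmulZr uZ.
Qed.

Let gnsL_bound a u : exists M, forall b, u (star a ** b) ^+ 2 <= M * D b.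
Proof.
have [M h] := gns_bound u; exists (`|M| * rnorm (star a) ^+ 2) => b.
apply: le_trans (h _) _; rewrite -mulrA.
apply: (le_trans (ler_wpM2r (gns_form_ge0 _ _) (ler_norm M))).
by rewrite ler_wpM2l// gns_form_cmul.
Qed.

(** Forced by the adjoint rule: [u b] being the real product of u with the class of b, the product
    of a u with that class is the one of u with the class of a^* b. *)
Definition gnsL a u : gns f := Gns (gnsL_linear a u) (gnsL_bound a u).

Lemma gnsL_norm a u : gns_norm (gnsL a u) <= rnorm a * gns_norm u.
Proof.
apply: gns_norm_le => [|b]; first by rewrite mulr_ge0 ?rnorm_ge0 ?gns_norm_ge0.
apply: (le_trans (ler_norm _)); apply: (le_trans (gns_abs_le u _)).
rewrite (mulrC (rnorm a)) -mulrA ler_wpM2l ?gns_norm_ge0//.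
rewrite -[X in X * _](@ger0_norm _ (rnorm a)) ?rnorm_ge0//.
rewrite -sqrtr_sqr -sqrtrM ?sqr_ge0// ler_sqrt.
  by rewrite -rnorm_star gns_form_cmul.
by rewrite mulr_ge0 ?sqr_ge0// gns_form_ge0.
Qed.

Lemma gnsL_is_linear a : linear (gnsL a).
Proof.
move=> c u v; apply: gns_eq => b.
rewrite -[LHS]/(u (conjc c *: (star a ** b)) + v (star a ** b)).
by rewrite -[RHS]/(u (star a ** (conjc c *: b)) + v (star a ** b)) cmulZr.
Qed.

HB.instance Definition _ a :=
  GRing.isLinear.Build R[i] (gns f) (gns f) *:%R (gnsL a) (gnsL_is_linear a).

Lemma gnsL_continuous a : continuous (gnsL a).
Proof.
exact: (@bounded_linear_continuous_rnorm R (gns f) (gns f) (gnsL a) (rnorm a)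
  (gnsL_norm a)).
Qed.

Definition gns_op a : bounded_op (gns f) :=
  @BoundedOp R[i] (gns f) (gnsL a) (@gnsL_continuous a).

Let gns_adjoint_re a u v : redot (gnsL a u) v = redot u (gnsL (star a) v).
Proof.
apply/eqP; rewrite -subr_eq0 -normr_le0.
(* The identity is exact when v is the class of an element of A. Replacing v by a class x costs at
   most K |v - x|, one half of [K] for each side. *)
pose K := (rnorm a + rnorm a) * gns_norm u.
have K0 : 0 <= K by rewrite !mulr_ge0 ?addr_ge0 ?rnorm_ge0 ?gns_norm_ge0.
apply/ler_addgt0Pr => e e0; rewrite add0r.
have K1 : 0 < K + 1 by rewrite ltr_wpDl.
have eK : 0 < (e / (K + 1)) ^+ 2 by rewrite exprn_gt0// divr_gt0.
have [x] := gns_vec_dense v eK.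
rewrite ler_pXn2r ?nnegrE ?gns_norm_ge0 ?divr_ge0 ?(ltW e0) ?(ltW K1)// => vx.
have xE : redot (gnsL a u) (gns_vec f x) = redot u (gnsL (star a) (gns_vec f x)).
  have -> : gnsL (star a) (gns_vec f x) = gns_vec f (star a ** x).
    apply: gns_eq => b; rewrite -[LHS]/(f (star (star (star a) ** b) ** x)).
    by rewrite -[RHS]/(f (star b ** (star a ** x))) starM !starK cmulA.
  by rewrite !redot_vec.
have CS (y z : gns f) : `|redot y z| <= gns_norm y * gns_norm z.
  rewrite -(@ler_pXn2r _ 2) ?nnegrE ?mulr_ge0 ?gns_norm_ge0//.
  by rewrite real_normK ?num_real// [leRHS]exprMn redot_CS.
have lin (y z : gns f) : redot (gnsL a u) y - redot u (gnsL (star a) y) =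
    redot (gnsL a u) (y - z) - redot u (gnsL (star a) (y - z)) +
    (redot (gnsL a u) z - redot u (gnsL (star a) z)).
  have BB (w : gns f) y' z' : redot w (y' - z') = redot w y' - redot w z'.
    by rewrite redotC (redotDl par) redotNl !(redotC w).
  by rewrite [gnsL (star a) (y - z)]linearB !BB; ring.
rewrite (lin v (gns_vec f x)) xE subrr addr0.
rewrite (le_trans (ler_normB _ _))//.
apply: (le_trans (lerD (CS _ _) (CS _ _))).
have B1 := ler_wpM2r (gns_norm_ge0 (v - gns_vec f x)) (gnsL_norm a u).
have B2 := ler_wpM2l (gns_norm_ge0 u) (gnsL_norm (star a) (v - gns_vec f x)).
apply: (le_trans (lerD B1 B2)); rewrite rnorm_star.
rewrite (_ : _ + _ = K * gns_norm (v - gns_vec f x)); last first.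
  by rewrite /K; ring.
apply: (le_trans (ler_wpM2l K0 vx)); rewrite mulrA ler_pdivrMr//.
by rewrite mulrC ler_pM2l// lerDl.
Qed.

Lemma gns_op_star_morphism : star_morphism gns_op.
Proof.
split=> [c a b u|a b u|a u v].
- apply: gns_eq => x; rewrite -[LHS]/(u (star (c *: a + b) ** x)).
  rewrite -[RHS]/(u (star a ** (conjc c *: x)) + u (star b ** x)).
  have [uD _] := gns_linear u.
  by rewrite starD starZ cmulDl cmulZl cmulZr uD.
- apply: gns_eq => x; rewrite -[LHS]/(u (star (a ** b) ** x)).
  by rewrite -[RHS]/(u (star b ** (star a ** x))) starM cmulA.
- rewrite -[LHS]/(jvn_dot (gnsL a u) v) -[RHS]/(jvn_dot u (gnsL (star a) v)).
  by rewrite /jvn_dot !gns_adjoint_re [gnsL _ (_ *: _)]linearZ.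
Qed.

Definition gns_rep : representation A := Representation gns_op_star_morphism.


End GNSRep.

(** * Pure states and irreducibility *)

Section PureState.
Context (R : realType) (A : cstarAlgType R[i]) (f : posfun A).
Implicit Types (a b : A) (c : R[i]) (r t k : R) (u v w : gns f).

Lemma gnsL_vec a b : gnsL a (gns_vec f b) = gns_vec f (a ** b).
Proof.
apply: gns_eq => x; rewrite -[LHS]/(f (star (star a ** x) ** b)).
by rewrite -[RHS]/(f (star x ** (a ** b))) starM starK cmulA.
Qed.

Lemma gns_norm_vec a : gns_norm (gns_vec f a) ^+ 2 = gns_form f a.
Proof.
rewrite -[gns_vec f a]add0r gns_norm_add_vec -[(0 : gns f) a]/(0 : R) mulr0 addr0.
suff -> : gns_norm (0 : gns f) = 0 by rewrite expr0n add0r.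
by rewrite -(scale0r (0 : gns f)) gns_normZ /cabs normr0 mul0r.
Qed.

Lemma gnsL_adjoint a u v : redot (gnsL a u) v = redot u (gnsL (star a) v).
Proof.
have [_ _ /(_ a u v)] := gns_op_star_morphism f.
by case.
Qed.

Lemma redot_hdot_eq0 u v : hdot (u : gns f) v = 0 -> redot u v = 0.
Proof. by case. Qed.

Lemma gns_vec_cyclic (W : set (gns f)) : closed_subspace W ->
  (forall a, W (gns_vec f a)) -> W = setT.
Proof.
move=> Ws Wa; apply/seteqP; split=> // u _.
have [w Ww uw] := ex_orthogonal_projection u Ws.
suff /eqP : u - w = 0 by rewrite subr_eq0 => /eqP ->.
apply: gns_eq => a; rewrite -redot_vec; apply: redot_hdot_eq0; exact: uw.
Qed.

Let par := @gns_parallelogram R A f.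

Let cyc := gns_vec f cone.

Let redotDr u v w : redot u (v + w) = redot u v + redot u w.
Proof. by rewrite redotC (redotDl par) !(redotC u). Qed.

Lemma gns_state_eq a : redot (gnsL a cyc) cyc = f a.
Proof.
rewrite gnsL_vec cmula1 redot_vec -[LHS]/(f (star cone ** a)).
by rewrite star1 cmul1a.
Qed.

Lemma gns_cyc_eq a : cyc a = f a.
Proof. by rewrite -[LHS]/(f (star a ** cone)) cmula1 posfun_star. Qed.

Definition vector_functional u a := redot (gnsL a u) u.

Lemma vector_functional_linear u : real_linear (vector_functional u).
Proof.
rewrite /vector_functional; split=> [a b|r a].
  rewrite -(redotDl par); congr redot; apply: gns_eq => x.
  rewrite -[LHS]/(u (star (a + b) ** x)) starD cmulDl.
  by have [-> _] := gns_linear u.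
rewrite -(redotZl par); congr redot; apply: gns_eq => x.
rewrite -[LHS]/(u (star (r%:C *: a) ** x)) -[RHS]/(u (star a ** (conjc r%:C *: x))).
by rewrite conjc_real starZ_real cmulZl cmulZr.
Qed.

Lemma vector_functional_star u a :
  vector_functional u (star a) = vector_functional u a.
Proof. by rewrite /vector_functional gnsL_adjoint starK redotC. Qed.

Lemma vector_functional_pos u a : pos a -> 0 <= vector_functional u a.
Proof.
move=> [b sb ->]; rewrite /vector_functional.
have -> : gnsL (b ** b) u = gnsL b (gnsL b u).
  apply: gns_eq => x; rewrite -[LHS]/(u (star (b ** b) ** x)).
  by rewrite -[RHS]/(u (star b ** (star b ** x))) starM cmulA.
by rewrite gnsL_adjoint sb redot_norm sqr_ge0.
Qed.

Lemma gnsL_cone u : gnsL cone u = u.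
Proof.
by apply: gns_eq => x; rewrite -[LHS]/(u (star cone ** x)) star1 cmul1a.
Qed.

Lemma vector_functional_cone u : vector_functional u cone = gns_norm u ^+ 2.
Proof. by rewrite /vector_functional gnsL_cone redot_norm gns_rnormE. Qed.

(* A proper invariant subspace splits the cyclic vector into two orthogonal
   components, which decomposes [f] into a convex combination. *)
Lemma pure_irreducible : f cone = 1 ->
  (forall t u v, 0 < t < 1 -> gns_norm u = 1 -> gns_norm v = 1 ->
    (forall a, t * vector_functional u a + (1 - t) * vector_functional v a = f a) ->
    vector_functional u = f) ->
  irreducible (gns_rep f).
Proof.
move=> f1 fext; have cyc1 : gns_norm cyc ^+ 2 = 1.
  by rewrite gns_norm_vec /gns_form star1 cmul1a.
split.
  exists cone, cyc; apply/eqP => h.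
  have : gnsL cone cyc = 0 by exact: h.
  rewrite gnsL_cone => c0; move: cyc1; rewrite c0.
  rewrite -(scale0r (0 : gns f)) gns_normZ /cabs normr0 mul0r expr0n /=.
  by move/eqP; rewrite eq_sym oner_eq0.
move=> W Ws Winv; have {}Winv a (u : gns f) : W u -> W (gnsL a u) by exact: Winv.
have WT : W cyc -> W = setT.
  move=> Wc; apply: gns_vec_cyclic => // a.
  by rewrite -[a]cmula1 -gnsL_vec; exact: Winv.
have [w Ww cw] := ex_orthogonal_projection cyc Ws.
pose z := cyc - w.
have zW x : W x -> redot z x = 0 by move=> Wx; apply: redot_hdot_eq0; exact: cw.
have cwz : cyc = w + z by rewrite /z addrCA subrr addr0.
pose t := gns_norm w ^+ 2.
have split_norm : t + gns_norm z ^+ 2 = 1.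
  have := gns_norm_sub cyc w; rewrite -/z cyc1 {1}cwz (redotDl par).
  by rewrite (zW w Ww) addr0 redot_norm gns_rnormE -/t => ->; ring.
(* If [cyc] is orthogonal to W, so is every class, by invariance; a vector y of W then has all its
   values y a equal to zero. *)
have [t0|tn] := eqVneq t 0.
  left; apply/seteqP; split=> [y Wy|_ ->]; last by case: Ws.
  apply: gns_eq => a.
  have w0 : w = 0.
    by apply: gns_norm_eq0; apply/eqP; rewrite -sqrf_eq0 -/t t0.
  rewrite -redot_vec -[a]cmula1 -gnsL_vec -[a]starK -gnsL_adjoint redotC.
  have -> : gns_vec f cone = z by rewrite /z w0 subr0.
  by apply: zW; exact: Winv.
right; apply: WT.
have [z0|zn] := eqVneq (gns_norm z) 0.
  by rewrite cwz (gns_norm_eq0 z0) addr0.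
have zp : 0 < gns_norm z ^+ 2 by rewrite exprn_gt0// lt_def zn gns_norm_ge0.
have tp : 0 < t by rewrite lt_def tn sqr_ge0.
have wn : gns_norm w != 0 by apply: contra tn => /eqP wz; rewrite /t wz expr0n.
pose nw := ((gns_norm w)^-1)%:C *: w; pose nz := ((gns_norm z)^-1)%:C *: z.
have unit u : gns_norm u != 0 -> gns_norm (((gns_norm u)^-1)%:C *: u) = 1.
  by move=> un; rewrite gns_normZ cabs_real ?invr_ge0 ?gns_norm_ge0// mulVf.
have vfZ (u : gns f) a : gns_norm u != 0 ->
    gns_norm u ^+ 2 * vector_functional (((gns_norm u)^-1)%:C *: u) a =
    vector_functional u a.
  move=> un; rewrite /vector_functional [gnsL a (_ *: u)]linearZ (redotZl par).
  by rewrite redotC (redotZl par) redotC; field.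
have cross a : vector_functional w a + vector_functional z a = f a.
  rewrite -gns_state_eq -/cyc cwz.
  have -> : gnsL a (w + z) = gnsL a w + gnsL a z by exact: linearD.
  rewrite (redotDl par) !(redotDr _ w z).
  rewrite (redotC (gnsL a w) z) (zW _ (Winv a _ Ww)) addr0.
  by rewrite (gnsL_adjoint a z w) (zW _ (Winv _ _ Ww)) add0r.
have fw : vector_functional nw = f.
  apply: (fext t nw nz); rewrite ?unit//.
    by rewrite tp/=; lra.
  move=> a; have -> : 1 - t = gns_norm z ^+ 2 by lra.
  by rewrite !vfZ.
(* By extremality the functional of w is t f. As z is orthogonal to W, this reads w = t cyc. *)
have -> : cyc = (t^-1)%:C *: w.
  apply: gns_eq => a.
  have [_ wZ] := gns_linear w.
  rewrite -[RHS]/(w (conjc (t^-1)%:C *: a)) conjc_real wZ gns_cyc_eq.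
  rewrite -posfun_star -[X in X _ = _]fw -[LHS]mul1r -(mulVf tn) -mulrA vfZ//.
  congr (_ * _).
  have -> : w a = redot (gnsL (star a) w) cyc.
    by rewrite gnsL_adjoint starK gnsL_vec cmula1 redot_vec.
  by rewrite cwz (redotDr _ w z) (redotC _ z) (zW _ (Winv _ _ Ww)) addr0.
exact: subspaceZ.
Qed.

End PureState.

(** * Irreducible representations attaining a norm modulo an ideal *)

Section PositiveModIdeal.
Context (R : realType) (A : cstarAlgType R[i]) (J : set A).
Hypothesis Ji : closed_ideal J.
Implicit Types (a b k x y z : A) (c : R[i]) (r t : R).
Local Notation scalar r := (r%:C *: (cone : A)).

Definition re x : A := (2^-1 : R)%:C *: (x + star x).

Lemma re_sa x : star x = x -> re x = x.
Proof.
move=> sx; rewrite /re sx -mulr2n -(scaler_nat 2 x) scalerA.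
by rewrite -(rmorph_nat (real_complex R)) -rmorphM mulVf ?pnatr_eq0// scale1r.
Qed.

Lemma star_re x : star (re x) = re x.
Proof. by rewrite /re starZ_real starD starK addrC. Qed.

Lemma reD x y : re (x + y) = re x + re y.
Proof. by rewrite /re starD addrACA scalerDr. Qed.

Lemma reZ r x : re (r%:C *: x) = r%:C *: re x.
Proof. by rewrite /re starZ_real -scalerDr !scalerA mulrC. Qed.

Lemma reN x : re (- x) = - re x.
Proof. by rewrite /re starN -opprD scalerN. Qed.

(* Positivity of the image of [x] in the quotient by [J]. *)
Definition pos_mod x := exists k, [/\ J k, pos k & pos (x + k)].

Lemma pos_mod_pos x : pos x -> pos_mod x.
Proof.
move=> px; exists 0; split; [by case: Ji|exact: pos0|by rewrite addr0].
Qed.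

Lemma pos_modD x y : pos_mod x -> pos_mod y -> pos_mod (x + y).
Proof.
case: Ji => _ _ JD _ [k [Jk pk pxk]] [l [Jl pl pyl]].
by exists (k + l); rewrite addrACA; split; [exact: JD|exact: posD|exact: posD].
Qed.

Lemma pos_modZ r x : 0 <= r -> pos_mod x -> pos_mod (r%:C *: x).
Proof.
case: Ji => _ _ _ JM r0 [k [Jk pk pxk]]; have rC : 0 <= r%:C by rewrite ler0c.
exists (r%:C *: k); rewrite -scalerDr; split; [|exact: posZ|exact: posZ].
by have [+ _] := JM k (scalar r) Jk; rewrite cmulZl cmul1a.
Qed.

Lemma pos_mod_opp k : J k -> pos k -> pos_mod (- k).
Proof. by move=> Jk pk; exists k; rewrite addNr; split=> //; exact: pos0. Qed.

Lemma pos_scalar_sub_sa x : star x = x -> pos (scalar (rnorm x) - x).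
Proof.
move=> sx; have [||b [sb bb _ _]] :=
  sqrt_near_scalar (t := `|x|) (x := `|x| *: cone - x).
- by rewrite starB starZ_ge0// star1 sx.
- by rewrite opprB addrCA subrr addr0.
- by exists b; rewrite // -rnormE.
Qed.

Let S x : set R := [set r | pos_mod (scalar r - re x)].

Let S_ex x : exists r, S x r.
Proof. by exists (rnorm (re x)); apply/pos_mod_pos/pos_scalar_sub_sa/star_re. Qed.

Let S_add x y r t : S x r -> S y t -> S (x + y) (r + t).
Proof.
move=> Sx Sy; rewrite /S /= rmorphD scalerDl reD opprD addrACA.
exact: pos_modD.
Qed.

Let S_scale x r t : 0 <= t -> S x r -> S (t%:C *: x) (t * r).
Proof.
by move=> t0 Sx; rewrite /S /= rmorphM reZ -scalerA -scalerBr; exact: pos_modZ.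
Qed.

(* The supremum of the spectrum of [re x] in the quotient by [J].  The infimum
   is junk if [J] is not proper, a case that [Hl0] excludes. *)
Definition mod_norm x := inf (S x).

Context (x0 : A) (l0 : R) (sx0 : star x0 = x0).
Hypothesis Hl0 : forall r, r < l0 -> ~ pos_mod (scalar r - x0).

Let S0_ge0 r : S 0 r -> 0 <= r.
Proof.
move=> S0; rewrite leNgt; apply/negP => r0.
(* A negative bound [r] for 0 could be scaled by [s] until s r + M, a bound for x0, is below
   [l0]. *)
pose M := rnorm x0; pose s := (`|M| + `|l0| + 1) / - r.
have s0 : 0 <= s by rewrite divr_ge0 ?oppr_ge0 ?(ltW r0)// !addr_ge0.
have SM : S x0 M.
  by rewrite /S /= re_sa//; exact/pos_mod_pos/pos_scalar_sub_sa.
have := S_add (S_scale s0 S0) SM; rewrite scaler0 add0r /S /= re_sa//.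
apply: Hl0; have -> : s * r = - (`|M| + `|l0| + 1).
  by rewrite /s; field; rewrite lt_eqF.
by have := ler_norm M; have := ler_norm (- l0); rewrite normrN; lra.
Qed.

Let S_inf x : has_inf (S x).
Proof.
split; first exact: S_ex.
have [r Sr] := S_ex (- x); exists (- r) => t St.
have := S_add St Sr; rewrite subrr => /S0_ge0; lra.
Qed.

Let N_le x r : S x r -> mod_norm x <= r.
Proof. by move=> Sr; apply: ge_inf => //; case: (S_inf x). Qed.

Let le_N x r : (forall t, S x t -> r <= t) -> r <= mod_norm x.
Proof. by move=> h; apply: lb_le_inf; first by case: (S_inf x). Qed.

Let N_sublinear : sublinear mod_norm.
Proof.
split=> [x y|r x].
  rewrite -lerBlDr; apply: le_N => t St; rewrite lerBlDr -lerBlDl.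
  apply: le_N => s Ss; rewrite lerBlDl; apply: N_le.
  exact: S_add.
rewrite le_eqVlt => /orP[/eqP<-|r0].
  rewrite scale0r mul0r; apply/eqP; rewrite eq_le; apply/andP; split.
    apply: N_le; rewrite /S /= scale0r re_sa ?star0// subr0.
    exact/pos_mod_pos/pos0.
  by apply: le_N => t; exact: S0_ge0.
apply/eqP; rewrite eq_le; apply/andP; split.
  rewrite -ler_pdivrMl//; apply: le_N => t St; rewrite ler_pdivrMl//.
  by apply: N_le; apply: S_scale => //; exact: ltW.
apply: le_N => t St; rewrite -ler_pdivlMl//; apply: N_le.
have ri : 0 <= r^-1 by rewrite invr_ge0 ltW.
have := S_scale ri St.
by rewrite scalerA -rmorphM mulVf ?gt_eqF// scale1r.
Qed.

(** The state is an extreme functional below [mod_norm] that agrees with it at x0; its value there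
    is at least [l0] by [Hl0]. Being below [mod_norm], tested at elements and their opposites, gives
    invariance under [star], positivity, normalization and vanishing on the positive elements of
    J. *)
Theorem ex_irreducible_above : exists rho : representation A,
  [/\ irreducible rho, J `<=` rker rho & exists v : rep_space rho,
    [/\ `|v| = 1, rho cone v = v & l0 <= complex.Re (hdot (rho x0 v) v)]].
Proof.
have [f [lf fN fx0 fext]] := ex_extreme_functional x0 N_sublinear.
have re_skew a : f (star a) = f a.
  have h b : re b = 0 -> f b <= 0.
    move=> b0; apply: le_trans (fN b) _; apply: N_le; rewrite /S /= b0 subr0 scale0r.
    exact/pos_mod_pos/pos0.
  have r0 : re (a - star a) = 0.
    by rewrite /re starB starK addrA subrK subrr scaler0.
  have := h _ r0; have := h (- (a - star a)); rewrite reN r0 oppr0 => /(_ erefl).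
  by have [fD _] := lf; rewrite (real_linearN _ lf) fD (real_linearN _ lf); lra.
have fpos b : pos b -> 0 <= f b.
  move=> pb; rewrite -lerN2 oppr0 -(real_linearN _ lf).
  apply: le_trans (fN _) _; apply: N_le.
  rewrite /S /= scale0r sub0r reN opprK re_sa ?(pos_star_id pb)//.
  exact: pos_mod_pos.
pose F := PosFun lf re_skew fpos.
have f1 : f cone = 1.
  have sc : star cone = cone :> A by exact: star1.
  apply/eqP; rewrite eq_le; apply/andP; split.
    apply: le_trans (fN _) _; apply: N_le; rewrite /S /= re_sa// scale1r subrr.
    exact/pos_mod_pos/pos0.
  rewrite -lerN2 -(real_linearN _ lf); apply: le_trans (fN _) _; apply: N_le.
  rewrite /S /= reN re_sa// rmorphN1 scaleN1r subrr.
  exact/pos_mod_pos/pos0.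
have fJ k : J k -> pos k -> f k = 0.
  move=> Jk pk; apply/eqP; rewrite eq_le fpos// andbT.
  apply: le_trans (fN _) _; apply: N_le.
  rewrite /S /= scale0r sub0r re_sa ?(pos_star_id pk)//.
  exact: pos_mod_opp.
(* Vanishing on positive elements is enough: the value of j u at b is controlled by the form at j^*
   b, that is by f at b^* j j^* b. *)
have killJ : J `<=` rker (gns_rep F).
  move=> j Jj u; have [_ _ _ JM] := Ji.
  apply: gns_eq => b; apply/eqP; rewrite -normr_le0.
  apply: le_trans (gns_abs_le u (star j ** b)) _.
  suff -> : gns_form F (star j ** b) = 0 by rewrite sqrtr0 mulr0.
  apply: fJ; last exact: pos_star_cmul.
  rewrite starM starK -cmulA; apply: (JM _ _ _).1.
  by apply: (JM _ _ _).2.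
have irr : irreducible (gns_rep F).
  apply: pure_irreducible => // t u v t01 u1 v1 uv.
  (* Since the representation kills J, the functional of a unit vector is below [mod_norm], so
     extremality applies to the decompositions of [pure_irreducible]. *)
  have dom (w : gns F) : gns_norm w = 1 -> dominated (vector_functional w) mod_norm.
    move=> w1 a; apply: le_N => r [k [Jk pk]] /(vector_functional_pos w).
    have [D Z] := vector_functional_linear w.
    rewrite !D (real_linearN _ (vector_functional_linear w)) Z.
    rewrite vector_functional_cone w1 expr1n mulr1.
    have -> : vector_functional w (re a) = vector_functional w a.
      by rewrite /re Z D vector_functional_star; field.
    have -> : vector_functional w k = 0.
      rewrite /vector_functional.
      have -> : gnsL k w = 0 by exact: (killJ k Jk w).
      by rewrite redotC /redot addr0 subr0 subrr mul0r.
    by rewrite addr0 subr_ge0.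
  apply: (fext t _ (vector_functional v)) => //;
    by [exact: vector_functional_linear|exact: dom].
exists (gns_rep F); split=> //; exists (gns_vec F cone); split.
- rewrite rnormE gns_rnormE; congr (_ %:C); apply/eqP.
  rewrite -(@eqrXn2 _ 2) ?gns_norm_ge0// gns_norm_vec /gns_form star1 cmul1a.
  by rewrite expr1n; apply/eqP.
- exact: gnsL_cone.
- rewrite -[complex.Re _]/(redot (gnsL x0 (gns_vec F cone)) (gns_vec F cone)).
  rewrite gns_state_eq -[leRHS]/(f x0) fx0; apply: le_N => r.
  rewrite /S /= re_sa// => h; rewrite leNgt; apply/negP => rl.
  exact: Hl0 rl h.
Qed.

End PositiveModIdeal.

(** * Positivity and norm estimates in a representation *)

Section Representations.
Context (R : realType) (A : cstarAlgType R[i]) (phi : representation A).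
Implicit Types (a b p q x y : A) (r t : R) (v w : rep_space phi).

Lemma rep_pos x v : pos x -> 0 <= hdot (phi x v) v.
Proof. by move=> [b sb ->]; rewrite repM rep_star sb hdot_ge0. Qed.

Lemma rep_pos_eq0 x v : pos x -> hdot (phi x v) v = 0 -> phi x v = 0.
Proof.
by move=> [b sb ->]; rewrite repM rep_star sb => /hdot_eq0 ->; rewrite linear0.
Qed.

(** [phi cone] is a projection, possibly not the identity; the difference of the two sides is the
    squared norm of v - phi cone v. *)
Lemma rep_cone_le v : hdot (phi cone v) v <= hdot v v.
Proof.
have sym : hdot (phi cone v) v = hdot v (phi cone v) by rewrite rep_star star1.
rewrite -subr_ge0; apply: le_trans (hdot_ge0 (v - phi cone v)) _.
by rewrite hdotBl !hdotBr sym (rep_star cone) star1 -repM cmul1a subrr subr0.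
Qed.

Lemma rep_star_cmul a v : hdot (phi (star a ** a) v) v = hdot (phi a v) (phi a v).
Proof. by rewrite repM rep_star starK. Qed.

Lemma rep_rnorm_le a v : rnorm (phi a v) <= rnorm a * rnorm v.
Proof.
rewrite -(@ler_pXn2r _ 2) ?nnegrE ?mulr_ge0 ?rnorm_ge0// exprMn.
rewrite -lecR rnorm_hdot rmorphM /= rnorm_hdot.
have pa : pos ((rnorm a ^+ 2)%:C *: cone - star a ** a).
  apply: pos_scalar_sub; first exact: pos_star_cmul.
  by rewrite cstar_identity rnormE -rmorphXn.
have := rep_pos v pa; rewrite repB repZ hdotBl hdotZl rep_star_cmul subr_ge0.
move/le_trans; apply; rewrite ler_wpM2l ?rep_cone_le//.
by rewrite ler0c sqr_ge0.
Qed.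

(** On w = phi p v the element [q] acts as zero, so p is both positive and negative there; hence phi
    p w = 0, and |w|^2 = <v, phi p w> = 0. *)
Lemma rep_pos_part_eq0 p q : pos p -> pos q -> p ** q = 0 ->
  (forall v, hdot (phi (p - q) v) v <= 0) -> forall v, phi p v = 0.
Proof.
move=> pp pq pq0 h v; set w := phi p v.
have qp0 : q ** p = 0.
  by rewrite -(pos_star_id pp) -(pos_star_id pq) -starM pq0 star0.
have yw : phi (p - q) w = phi p w.
  by rewrite /w -!repM cmulBl qp0 subr0.
have pw : phi p w = 0.
  apply: rep_pos_eq0 => //; apply/eqP; rewrite eq_le rep_pos// andbT.
  by rewrite -{1}yw h.
apply: hdot_eq0.
by rewrite {1}/w rep_star (pos_star_id pp) pw hdot0r.
Qed.

Lemma opnorm_le (H : normedModType R[i]) (T : bounded_op H) r : 0 <= r ->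
  (forall v : H, rnorm (T v) <= r * rnorm v) -> opnorm T <= r.
Proof.
move=> r0 h; apply: ge_sup.
  by exists 0; exists 0; rewrite ?normr0// linear0 normr0.
move=> _ [v v1] /(congr1 (@complex.Re R)) /= <-.
apply: le_trans (h v) _; rewrite ler_piMr// -lecR -rnormE.
exact: v1.
Qed.

Lemma rep_opnorm_eq a v : `|v| = 1 -> rnorm (phi a v) = rnorm a ->
  `|a| = (opnorm (phi a))%:C.
Proof.
move=> v1 av; rewrite rnormE; congr (_ %:C); apply/eqP; rewrite eq_le.
apply/andP; split; last first.
  by apply: opnorm_le; [exact: rnorm_ge0|exact: rep_rnorm_le].
apply: sup_ubound; last by exists v; rewrite ?v1// rnormE av.
exists (rnorm a) => _ [w w1] /(congr1 (@complex.Re R)) /= <-.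
apply: le_trans (rep_rnorm_le a w) _; rewrite ler_piMr ?rnorm_ge0// -lecR -rnormE.
exact: w1.
Qed.

End Representations.

(** * Ideals that an irreducible representation does not kill *)

Section Irreducible.
Context (R : realType) (A : cstarAlgType R[i]).
Implicit Types (a b e h j p q x y : A) (J : set A) (r t : R).

(** The vectors killed by [J] form a closed invariant subspace. *)
Lemma ideal_rep_neq0 (pi : representation A) J (w : rep_space pi) :
  irreducible pi -> closed_ideal J -> ~ J `<=` rker pi -> w != 0 ->
  exists2 j, J j & pi j w != 0.
Proof.
move=> [_ irr] [_ _ _ JM] JK w0; apply: contrapT => nex.
have Jw j : J j -> pi j w = 0.
  by move=> Jj; apply/eqP; apply: contrapT => /negP h; apply: nex; exists j.
pose W : set (rep_space pi) := [set u | forall j, J j -> pi j u = 0].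
have [|u a||] := irr W.
- split.
  + rewrite (_ : W = \bigcap_(j in J) (pi j @^-1` [set 0])); last first.
      by apply/seteqP; split => u Wu j /Wu.
    apply: closed_bigI => j _; apply: preimage_closed; last first.
      exact/accessible_closed_set1/hausdorff_accessible/norm_hausdorff.
    by move=> u _; exact: bounded_op_continuous.
  + by move=> j _; rewrite linear0.
  + by move=> c u v Wu Wv j Jj; rewrite linearP Wu// Wv// scaler0 addr0.
- by move=> Wa j Jj; rewrite -repM; exact: (Wa _ (JM _ u Jj).2).
- move=> W0; have : W w by [].
  by rewrite W0 => /= w00; rewrite w00 eqxx in w0.
- move=> WT; apply: JK => j Jj v; suff /(_ _ Jj) : W v by [].
  by rewrite WT.
Qed.

Lemma irreducible_cone_neq0 (pi : representation A) : irreducible pi ->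
  exists v, pi cone v != 0.
Proof.
move=> [[a [v av]] _]; exists v; apply: contra av => /eqP v0.
by rewrite -[a]cmula1 repM v0 linear0.
Qed.

(* With [h = (j e)^* (j e)] for some [j] in [J], [e'] and [a] are the functions
   [(t - r)_+] and [min (t / r) 1] of [h], for a small [r > 0]. *)
Lemma norm_one_step (pi : representation A) J e :
  irreducible pi -> closed_ideal J -> ~ J `<=` rker pi ->
  star e = e -> (exists v, pi e v != 0) ->
  exists a e', [/\ star e' = e' /\ (exists v, pi e' v != 0), `|a| <= 1, a ** e' = e',
    forall b, b ** e = e -> b ** e' = e' &
    forall phi : representation A, J `<=` rker phi -> forall v, phi a v = 0].
Proof.
move=> irr Ji JK se [v0 ev0].
have [j Jj jv0] := ideal_rep_neq0 irr Ji JK ev0.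
pose g := j ** e; pose h := star g ** g.
have gv : pi g v0 != 0 by rewrite repM.
have ph : pos h by exact: pos_star_cmul.
have vn : v0 != 0 by apply: contra gv => /eqP ->; rewrite linear0.
have rp (H : hilbertType R[i]) (u : H) : u != 0 -> 0 < rnorm u.
  move=> u0; rewrite lt_def rnorm_ge0 andbT.
  by apply: contra u0 => /eqP/rnorm0_eq0 ->.
(* Half of the Rayleigh quotient of h at v0, so that h - r stays strictly positive at v0 and its
   positive part survives in [pi]. *)
pose r := rnorm (pi g v0) ^+ 2 / 2 / rnorm v0 ^+ 2.
have r0 : 0 < r by rewrite !divr_gt0 ?exprn_gt0 ?rp.
have rC : 0 < r%:C by rewrite ltcR.
have [|p [q [pp pq yE pq0]]] := @pos_neg_part _ _ (h - r%:C *: cone).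
  by rewrite starB starZ_real star1 (pos_star_id ph).
have sp := pos_star_id pp; have sq := pos_star_id pq.
have qp0 : q ** p = 0 by rewrite -sp -sq -starM pq0 star0.
have hE : h = r%:C *: cone + (p - q) by rewrite -yE addrCA subrr addr0.
(* Conjugating h >= 0 by q gives q^3 <= r q^2, as q p = 0; then |q|^4 = |q q^3| <= r |q|^3. *)
have qr : rnorm q <= r.
  have qn : `|q ** q| = `|q| ^+ 2 by exact: norm_sqr_sa.
  have q3 : pos (q ** q ** q) by rewrite -{1}sq; exact: pos_conj.
  have qhq : pos (r%:C *: (q ** q) - q ** q ** q).
    have := pos_conj q ph; rewrite sq hE cmulDr cmulBr qp0 sub0r cmulZr.
    by rewrite cmula1 cmulDl cmulNl cmulZl.
  have n3 : `|q ** q ** q| <= r%:C * `|q| ^+ 2.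
    have := pos_mono q3 qhq; rewrite normrZ qn.
    by rewrite (gtr0_norm rC).
  have n4 : `|q| ^+ 4 <= `|q| * (r%:C * `|q| ^+ 2).
    rewrite (exprM `|q| 2 2) -qn -norm_sqr_sa ?starM ?sq// !cmulA.
    rewrite -(cmulA (q ** q)) -(cmulA q q (q ** q)) (cmulA q q q).
    by rewrite (le_trans (norm_cmul _ _))// ler_wpM2l// qn.
  rewrite leNgt; apply/negP => qr.
  have qC : 0 < `|q| by rewrite rnormE ltcR (lt_trans r0).
  move: n4; rewrite mulrCA -exprS (exprS _ 3) ler_pM2r ?exprn_gt0//.
  by rewrite rnormE lecR leNgt qr.
pose a := cone - r^-1%:C *: q.
exists a, p; split.
- split=> //; have [//|np] := pselect (exists v, pi p v != 0); exfalso.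
  have p0 v : pi p v = 0.
    by apply/eqP; apply: contrapT => /negP pv; apply: np; exists v.
  have : hdot (pi (p - q) v0) v0 <= 0.
    by rewrite repB p0 sub0r -scaleN1r hdotZl mulN1r oppr_le0 rep_pos.
  rewrite -yE repB hdotBl repZ hdotZl rep_star_cmul subr_le0.
  move/le_trans/(_ (ler_wpM2l (ltW rC) (rep_cone_le _))).
  rewrite -!rnorm_hdot -rmorphM lecR /r divfK ?gt_eqF ?exprn_gt0 ?rp//.
  have : 0 < rnorm (pi g v0) ^+ 2 by rewrite exprn_gt0 ?rp.
  lra.
- rewrite /a; have -> : cone - r^-1%:C *: q = r^-1%:C *: (r%:C *: cone - q).
    by rewrite scalerBr scalerA -rmorphM mulVf ?gt_eqF// scale1r.
  rewrite normrZ ger0_norm ?lecR ?invr_ge0 ?(ltW r0)// fmorphV ler_pdivrMl// mulr1.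
  by apply: pos_norm_sub => //; rewrite rnormE lecR.
- by rewrite /a cmulBl cmul1a cmulZl qp0 scaler0 subr0.
- move=> b be; pose c := cone - b.
  have ce : c ** e = 0 by rewrite cmulBl cmul1a be subrr.
  have ch : c ** h = 0.
    by rewrite /h /g starM se -!cmulA cmulA ce cmul0l.
  have cpp : c ** p ** p = - (r%:C *: (c ** p)).
    have hp : h ** p = r%:C *: p + p ** p.
      by rewrite hE cmulDl cmulBl qp0 subr0 cmulZl cmul1a.
    have : c ** (h ** p) = 0 by rewrite cmulA ch cmul0l.
    rewrite hp cmulDr cmulZr cmulA => /eqP.
    by rewrite addrC addr_eq0 => /eqP.
  suff : c ** p = 0 by rewrite cmulBl cmul1a => /eqP; rewrite subr_eq0 => /eqP <-.
  (* From c h = 0 and h p = r p + p^2 one gets c p^2 = - r c p, so the positive elements d d^* and r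
     c p c^* add up to zero. *)
  pose d := c ** p; rewrite -/d.
  have dd : d ** star d = 0.
    apply: (@pos_addr_eq0 _ _ _ (r%:C *: (c ** p ** star c))).
    - by rewrite -{1}(starK d); exact: pos_star_cmul.
    - apply: posZ; first exact: ltW.
      by rewrite -{1}(starK c); exact: pos_conj.
    - by rewrite /d starM sp cmulA cpp cmulNl cmulZl addNr.
  apply/eqP; rewrite -normr_eq0 -star_norm -sqrf_eq0 -cstar_identity starK dd.
  by rewrite normr0.
- move=> phi Jphi v.
  (* With h killed, p - q acts as - r [phi cone]; so p acts as zero, q as r [phi cone], and a as
     zero. *)
  have hv u : phi h u = 0.
    by rewrite repM [phi g u]repM (Jphi _ Jj) linear0.
  have yv u : phi (p - q) u = - (r%:C *: phi cone u).
    by rewrite -yE repB hv sub0r repZ.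
  have pv0 : phi p v = 0.
    apply: rep_pos_part_eq0 pp pq pq0 _ v => u.
    rewrite yv -scaleN1r !hdotZl mulN1r oppr_le0 mulr_ge0 ?(ltW rC)//.
    by apply: rep_pos; exists cone; rewrite ?star1 ?cmul1a.
  rewrite /a repB repZ; have := yv v; rewrite repB pv0 sub0r => /oppr_inj ->.
  by rewrite scalerA -rmorphM mulVf ?gt_eqF// scale1r subrr.
Qed.

End Irreducible.

(** * Norming irreducible representations and open sets of primitive ideals *)

Section NormSeparation.
Context (R : realType) (A : cstarAlgType R[i]).
Implicit Types (a b e x : A) (J : set A) (r t : R).

Lemma hdot_rep_star_cmul (phi : representation A) a v :
  complex.Re (hdot (phi (star a ** a) v) v) = rnorm (phi a v) ^+ 2.
Proof. by rewrite rep_star_cmul -rnorm_hdot. Qed.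

(** The hypothesis says, without a quotient, that the norm of [a] does not drop modulo [J]. *)
Lemma ex_irreducible_norming J a : closed_ideal J ->
  (forall r, r < rnorm a ^+ 2 -> ~ pos_mod J (r%:C *: cone - star a ** a)) ->
  exists rho : representation A, [/\ irreducible rho, J `<=` rker rho,
    `|a| = (opnorm (rho a))%:C & exists v,
    [/\ `|v| = 1, rho cone v = v & rnorm (rho a v) = rnorm a]].
Proof.
move=> Ji h; have sx : star (star a ** a) = star a ** a by rewrite starM starK.
have [rho [irr Jrho [v [v1 vc va]]]] := ex_irreducible_above Ji sx h.
have av : rnorm (rho a v) = rnorm a.
  apply/eqP; rewrite eq_le; apply/andP; split.
    have vr : rnorm v = 1 by rewrite /rnorm v1.
    by have := rep_rnorm_le a v; rewrite vr mulr1.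
  by rewrite -(@ler_pXn2r _ 2) ?nnegrE ?rnorm_ge0// -hdot_rep_star_cmul.
exists rho; split=> //; first exact: rep_opnorm_eq av.
by exists v.
Qed.

Lemma closed_ideal0 : closed_ideal [set (0 : A)].
Proof.
split=> //.
- exact/accessible_closed_set1/hausdorff_accessible/norm_hausdorff.
- by move=> a b /= -> ->; rewrite addr0.
- by move=> a b /= ->; rewrite cmul0l cmul0r.
Qed.

(** The case J = 0 of [ex_irreducible_norming]. In the zero algebra it fails for negative [r], all
    scalars being positive there. *)
Lemma pos_mod0_norm a r : (cone : A) != 0 -> r < rnorm a ^+ 2 ->
  ~ pos_mod [set 0] (r%:C *: cone - star a ** a).
Proof.
move=> c0 ra [_ [-> _]]; rewrite addr0 => h.
have px := pos_star_cmul a.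
have [r0|r0] := leP 0 r.
  have rC : 0 <= r%:C by rewrite ler0c.
  have := pos_norm_le rC px h.
  by rewrite cstar_identity rnormE -rmorphXn lecR leNgt ra.
have rN : 0 <= (- r)%:C by rewrite ler0c oppr_ge0 ltW.
have := posD h px; rewrite subrK => pr.
have : r%:C *: (cone : A) = 0.
  apply: pos_antisym => //; rewrite -scaleNr -rmorphN.
  exact: pos_scalar.
move/eqP; rewrite scaler_eq0 (negbTE c0) orbF => /eqP /(congr1 (@complex.Re R)) /= re0.
by rewrite re0 ltxx in r0.
Qed.

(** In effect, the kernel of [phi] is an intersection of primitive ideals. If [j] in [J] acts
    nontrivially, j^* j has a positive spectral supremum modulo ker phi, attained in some
    irreducible [rho] killing ker phi. *)
Lemma ex_irreducible_sub_ideal (phi : representation A) J : ~ J `<=` rker phi ->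
  exists rho : representation A,
    [/\ irreducible rho, rker phi `<=` rker rho & ~ J `<=` rker rho].
Proof.
move=> /existsNP[j /not_implyP[Jj nj]].
have /existsNP[v jv] : ~ forall v, phi j v = 0 by [].
have jv0 : 0 < rnorm (phi j v).
  by rewrite lt_def rnorm_ge0 andbT; apply/eqP => /rnorm0_eq0.
have v0 : 0 < rnorm v.
  rewrite lt_def rnorm_ge0 andbT; apply/eqP => /rnorm0_eq0 vz.
  by apply: jv; rewrite vz linear0.
have sx : star (star j ** j) = star j ** j by rewrite starM starK.
pose l := rnorm (phi j v) ^+ 2 / rnorm v ^+ 2.
have l0 : 0 < l by rewrite divr_gt0// exprn_gt0.
have [|rho [irr ker [w [_ _ wl]]]] :=
    @ex_irreducible_above R A _ (rker_closed_ideal (@complex_half_expn R) phi) _ l sx.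
  move=> r rl [k [Jk pk /(rep_pos v)]].
  rewrite repD Jk addr0 repB hdotBl repZ hdotZl rep_star_cmul subr_ge0 => h.
  (* [r] may be negative, while [rep_cone_le] can only be scaled by a nonnegative factor. *)
  suff : (rnorm (phi j v) ^+ 2)%:C <= (Num.max r 0)%:C * (rnorm v ^+ 2)%:C.
    rewrite -rmorphM lecR -ler_pdivrMr ?exprn_gt0// leNgt => /negP; apply.
    by rewrite gt_max rl.
  rewrite !rnorm_hdot; apply: (le_trans h).
  apply: (@le_trans _ _ ((Num.max r 0)%:C * hdot (phi cone v) v)).
    rewrite ler_wpM2r ?lecR ?le_max ?lexx//.
    by apply: rep_pos; exists cone; rewrite ?star1 ?cmul1a.
  by rewrite ler_wpM2l ?rep_cone_le// ler0c le_max lexx orbT.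
exists rho; split=> // Jrho; move: wl; rewrite hdot_rep_star_cmul (Jrho _ Jj).
by rewrite /rnorm normr0 expr0n/= leNgt l0.
Qed.

(** The set is Prim(K), where the intersection K of the primitive ideals containing [e] stands in
    for the ideal generated by [e]. *)
Lemma prim_open_notin e : open [set I : Prim A | ~ prim_ideal I e].
Proof.
apply/prim_openE.
pose K := \bigcap_(I in [set I : Prim A | prim_ideal I e]) prim_ideal I.
have IP (I : Prim A) : closed_ideal (prim_ideal I).
  have [pi _ ->] := prim_idealP I.
  exact: rker_closed_ideal (@complex_half_expn R) pi.
exists K.
  split.
  - by apply: closed_bigI => I _; case: (IP I).
  - by move=> I _; case: (IP I).
  - by move=> a b Ka Kb I Ie; case: (IP I) => _ _ D _; apply: D; [exact: Ka|exact: Kb].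
  - move=> a b Ka; split=> I Ie; case: (IP I) => _ _ _ M.
      exact: (M a b (Ka I Ie)).1.
    exact: (M a b (Ka I Ie)).2.
apply/seteqP; split=> I /=; last by move=> KI Ie; apply: KI => a; exact.
by move=> Ie KI; apply: Ie; apply: KI => I'.
Qed.

End NormSeparation.

(** * Neighborhood bases from a norming element, and nested local units *)

Section StrictlyNormingExhausting.
Context (R : realType) (A : cstarAlgType R[i]).
Implicit Types (a b e x : A) (J : set A) (r t : R).

Lemma strictly_norming_countable :
  accessible_space (Prim A) ->
  (forall F : rep_family A, strictly_norming F -> exhausting F) ->
  forall I : Prim A, countable_nbhs_base I.
Proof.
move=> T1 snex I; have [pi piirr piE] := prim_idealP I.
have c0 : (cone : A) != 0.
  have [v] := irreducible_cone_neq0 piirr; apply: contra => /eqP ->.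
  by rewrite rep0.
have [a aI] : exists a, forall rho : representation A, irreducible rho ->
    `|a| = (opnorm (rho a))%:C -> rker rho = prim_ideal I.
  apply: contrapT => /forallNP na.
  have sn : strictly_norming (fun rho : representation A =>
      irreducible rho /\ rker rho <> prim_ideal I).
    move=> a; have /existsNP[rho /not_implyP[irr /not_implyP[ra ne]]] := na a.
    by exists rho.
  have [rho [irr ne] sub] := snex _ sn pi piirr.
  pose K := @PrimIdeal _ A (rker rho) (ex_intro2 _ _ rho irr erefl).
  have IK : I != K by apply/eqP => IK; apply: ne; rewrite IK.
  (* Separating I from K gives an ideal J inside ker rho but not inside I, against the inclusion of
     ker rho in I. *)
  have [U [/prim_openE[J _ ->] []]] := T1 I K IK.
  rewrite !inE /= => JI /contrapT JK; apply: JI; rewrite piE.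
  exact: subset_trans JK sub.
pose l : R := rnorm a ^+ 2; pose x := star a ** a.
have sx : star x = x by rewrite starM starK.
(* [e n] is the positive part of a^* a - (l - 1/(n+1)); the primitive ideals omitting it, an open
   set, are those at which a^* a exceeds l - 1/(n+1). *)
have /choice[e eP] n : exists p, exists q, [/\ pos p, pos q,
    x - (l - n.+1%:R^-1)%:C *: cone = p - q & p ** q = 0].
  by apply: pos_neg_part; rewrite starB starZ_real star1 sx.
have [rho [rirr _ ra [v [v1 vc va]]]] := ex_irreducible_norming (@closed_ideal0 _ A)
  (fun r => @pos_mod0_norm _ _ a r c0).
have Ie n : ~ prim_ideal I (e n).
  rewrite -(aI rho rirr ra) => re; have [q [pe pq xE _]] := eP n.
  have h : hdot (rho (x - (l - n.+1%:R^-1)%:C *: cone) v) v <= 0.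
    by rewrite xE repB re sub0r -scaleN1r hdotZl mulN1r oppr_le0 rep_pos.
  have vr : rnorm v = 1 by rewrite /rnorm v1.
  move: h; rewrite repB hdotBl repZ vc hdotZl rep_star_cmul -!rnorm_hdot va vr.
  rewrite expr1n mulr1 subr_le0 lecR -/l.
  by rewrite lerBrDr gerDl leNgt invr_gt0 ltr0n.
exists (range (fun n => [set I' : Prim A | ~ prim_ideal I' (e n)])); split.
- exact: card_image_le.
- move=> _ [n _ <-]; apply: open_nbhs_nbhs; split; last exact: Ie.
  exact: prim_open_notin.
move=> U; rewrite nbhsE => -[V [/prim_openE[J Ji ->] JI] VU].
(* Otherwise a would keep its norm modulo J and attain it in a representation killing J; by [aI] its
   kernel would be I, which does not contain J. *)
have [r rl [k [Jk pk pxk]]] : exists2 r, r < l & pos_mod J (r%:C *: cone - x).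
  apply: contrapT => nr.
  have [|sg [sirr Js sa _]] := @ex_irreducible_norming R A J a Ji.
    by move=> r rl pr; apply: nr; exists r.
  by apply: JI; rewrite -(aI sg sirr sa).
have lr : 0 < l - r by rewrite subr_gt0.
(* With 1/(n+1) < l - r, in a representation killing J the element a^* a is at most r < l - 1/(n+1),
   so [e n] is killed. *)
have [n _ /(_ n (leqnn n))/= nr] := near_infty_natSinv_lt (PosNum lr).
exists [set I' : Prim A | ~ prim_ideal I' (e n)]; first by exists n.
move=> I' /= I'e; apply: VU => JI'; apply: I'e.
have [sg _ sgE] := prim_idealP I'; rewrite sgE => w.
have [q [pe pq xE eq0]] := eP n; apply: rep_pos_part_eq0 pe pq eq0 _ w => w.
have k0 : sg k w = 0 by have := JI' k Jk; rewrite sgE; exact.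
have h := rep_pos w pxk.
rewrite -oppr_ge0; apply: le_trans h _; rewrite -xE.
rewrite repD k0 addr0 !repB !repZ !hdotBl !hdotZl opprB lerD2r.
rewrite ler_wpM2r ?lecR//; last by rewrite lerBrDr -lerBrDl ltW.
by apply: rep_pos; exists cone; rewrite ?star1 ?cmul1a.
Qed.

(** [norm_one_step] iterated from [cone]. Its clause on [b] passes every earlier a n on from one e m
    to the next. *)
Lemma nested_norm_one (pi : representation A) (J : nat -> set A) :
  irreducible pi -> (forall n, closed_ideal (J n)) ->
  (forall n, ~ J n `<=` rker pi) ->
  exists a : nat -> A, exists e : nat -> A,
    [/\ forall n, `|a n| <= 1, forall n, e n != 0,
        forall n m, (n < m)%N -> a n ** e m = e m &
        forall n (phi : representation A), J n `<=` rker phi ->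
          forall v, phi (a n) v = 0].
Proof.
move=> irr Ji JK.
pose T := {e : A | star e = e /\ exists v, pi e v != 0}.
have start : star (cone : A) = cone /\ exists v, pi cone v != 0.
  by split; [exact: star1|exact: irreducible_cone_neq0].
have /choice[F FP] (ne : nat * T) : exists ae : A * T,
    [/\ `|ae.1| <= 1, ae.1 ** sval ae.2 = sval ae.2,
      forall b, b ** sval ne.2 = sval ne.2 -> b ** sval ae.2 = sval ae.2 &
      forall phi : representation A, J ne.1 `<=` rker phi ->
        forall v, phi ae.1 v = 0].
  case: ne => n [e [se ev]] /=.
  have [a [e' [e'P a1 ae be ak]]] := norm_one_step irr (Ji n) (JK n) se ev.
  by exists (a, exist _ e' e'P).
pose E := fix E n : T := if n is m.+1 then (F (m, E m)).2 else exist _ cone start.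
exists (fun n => (F (n, E n)).1), (fun n => sval (E n)); split.
- by move=> n; have [] := FP (n, E n).
- move=> n; have [_ [v]] := svalP (E n).
  by apply: contra => /eqP ->; rewrite rep0.
- move=> n m; elim: m => // m ih; rewrite ltnS leq_eqVlt => /orP[/eqP<-|nm].
    by have [_ h _ _] := FP (n, E n).
  by have [_ _ h _] := FP (m, E m); apply: h; exact: ih.
- by move=> n; have [] := FP (n, E n).
Qed.

End StrictlyNormingExhausting.

(** * An element whose norm drops in each of countably many quotients *)

Section DyadicSeries.
Context (R : realType) (A : cstarAlgType R[i]).
Variable s : nat -> A.
Hypothesis s1 : forall n, `|s n| <= 1.
Local Notation h n := ((2^-1 : R[i]) ^+ n).

Lemma half_exp_gt0 n : 0 < h n.
Proof. by rewrite exprn_gt0// invr_gt0. Qed.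

Lemma half_expS n : h n = h n.+1 + h n.+1.
Proof.
by rewrite exprS -mulrDl (_ : 2^-1 + 2^-1 = 1) ?mul1r//; field.
Qed.

Definition dyadic_sum n := \sum_(k < n) h k.+1 *: s k.

Lemma dyadic_sumS n : dyadic_sum n.+1 = dyadic_sum n + h n.+1 *: s n.
Proof. by rewrite /dyadic_sum big_ord_recr. Qed.

Let term_le n : `|h n.+1 *: s n| <= h n.+1.
Proof.
rewrite normrZ ger0_norm ?(ltW (half_exp_gt0 _))// ler_piMr//.
Qed.

Lemma dyadic_sum_dist n m : (n <= m)%N ->
  `|dyadic_sum m - dyadic_sum n| <= h n - h m.
Proof.
move=> /subnKC <-; elim: (m - n)%N => [|k ih].
  by rewrite addn0 !subrr normr0.
rewrite addnS dyadic_sumS addrAC (le_trans (ler_normD _ _))//.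
apply: le_trans (lerD ih (term_le _)) _.
by rewrite [in h (n + k)]half_expS opprD addrA subrK.
Qed.

Lemma dyadic_limit : exists a, forall n, `|a - dyadic_sum n| <= h n.
Proof.
have dist n m : (n <= m)%N -> `|dyadic_sum m - dyadic_sum n| <= h n.
  move=> /dyadic_sum_dist /le_trans; apply.
  by rewrite gerBl ltW// half_exp_gt0.
have scvg : cvgn dyadic_sum.
  apply/cauchy_cvgP/cauchy_ballP => e e0; near_simpl.
  have e2 : 0 < e / 2 by rewrite divr_gt0.
  have [N Ne] := complex_half_expn e2.
  exists ([set n | N <= n], [set n | N <= n])%N; first by split; exists N.
  move=> [n m] [/= Nn Nm]; rewrite -ball_normE /=.
  rewrite -(subrK (dyadic_sum N) (dyadic_sum n)) -addrA.
  rewrite (le_lt_trans (ler_normD _ _))// [ltRHS]splitr.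
  rewrite ltrD//; first exact: le_lt_trans (dist _ _ Nn) Ne.
  by rewrite distrC; exact: le_lt_trans (dist _ _ Nm) Ne.
exists (limn dyadic_sum) => n; apply/ler_addgt0Pr => e e0.
move/cvgrPdist_le : (scvg) => /(_ _ e0)[N _ Ns].
have := Ns (maxn N n) (leq_maxl _ _) => /= Nn.
rewrite -(subrK (dyadic_sum (maxn N n)) (limn _)) -addrA.
rewrite (le_trans (ler_normD _ _))// [leRHS]addrC lerD//.
exact: dist (leq_maxr _ _).
Qed.

(** The weights 2^-1, ..., 2^-m add up to 1 - 2^-m, and the weight of the deleted term is
    subtracted. *)
Lemma dyadic_sum_sub n m : (n < m)%N ->
  `|dyadic_sum m - h n.+1 *: s n| <= 1 - h m - h n.+1.
Proof.
elim: m => // m ih; rewrite ltnS leq_eqVlt => /orP[/eqP nm|nm].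
  rewrite nm dyadic_sumS addrK -(subr0 (dyadic_sum m)).
  have -> : (0 : A) = dyadic_sum 0 by rewrite /dyadic_sum big_ord0.
  apply: le_trans (dyadic_sum_dist (leq0n m)) _.
  by rewrite expr0 [in leLHS]half_expS opprD addrA.
rewrite dyadic_sumS addrAC (le_trans (ler_normD _ _))//.
apply: le_trans (lerD (ih nm) (term_le _)) _.
by rewrite [in h m]half_expS opprD !addrA addrAC subrK.
Qed.

End DyadicSeries.

Section NormDrop.
Context (R : realType) (A : cstarAlgType R[i]).
Implicit Types (a b e x : A) (J : nat -> set A) (r t : R).
Local Notation h n := ((2^-1 : R[i]) ^+ n).

Lemma ex_norm_drop (pi : representation A) J :
  irreducible pi -> (forall n, closed_ideal (J n)) ->
  (forall n, ~ J n `<=` rker pi) ->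
  exists a, forall n (phi : representation A), J n `<=` rker phi ->
    `|a| <> (opnorm (phi a))%:C.
Proof.
move=> irr Ji JK; have [s [e [s1 e0 se sphi]]] := nested_norm_one irr Ji JK.
have [a aS] := dyadic_limit s1; exists a => n phi Jphi aphi.
have a1 : 1 <= `|a|.
  apply/ler_addgt0Pr => d d0.
  have d2 : 0 < d / 2 by rewrite divr_gt0.
  have [N Nd] := complex_half_expn d2.
  have eN : 0 < `|e N| by rewrite normr_gt0.
  (* The partial sum acts on [e N] as a scalar, so nothing cancels: (1 - h N) |e N| <= (|a| + h N)
     |e N|. *)
  have SE : dyadic_sum s N ** e N = (1 - h N) *: e N.
    have : forall m, (m <= N)%N -> dyadic_sum s m ** e N = (1 - h m) *: e N.
      elim=> [|m ih] mN.
        by rewrite /dyadic_sum big_ord0 cmul0l expr0 subrr scale0r.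
      rewrite dyadic_sumS cmulDl cmulZl (ih (ltnW mN)) se// -scalerDl.
      by rewrite [in h m]half_expS opprD addrA subrK.
    by apply.
  have hN1 : 0 <= 1 - h N by rewrite subr_ge0 exprn_ile1// invf_le1// ler1n.
  rewrite -(ler_pM2r eN) mul1r.
  have : `|dyadic_sum s N ** e N| <= (`|a| + h N) * `|e N|.
    rewrite (le_trans (norm_cmul _ _))// ler_wpM2r//.
    rewrite -(subrK a (dyadic_sum s N)) addrC (le_trans (ler_normD _ _))//.
    by rewrite lerD// distrC.
  rewrite SE normrZ (ger0_norm hN1) mulrBl mul1r lerBlDr -mulrDl => /le_trans.
  apply; rewrite ler_wpM2r// -addrA lerD2l [leRHS]splitr.
  by rewrite lerD// ltW.
(* A representation killing [J n] does not see the term of index n, and without it the weights total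
   only 1 - h n.+1. *)
have aS' : `|a - h n.+1 *: s n| <= 1 - h n.+1.
  rewrite -(subrK (dyadic_sum s n.+1) a) -addrA (le_trans (ler_normD _ _))//.
  rewrite (le_trans (lerD (aS _) (dyadic_sum_sub s1 (ltnSn n))))//.
  by rewrite addrC subrK.
have phiE v : phi a v = phi (a - h n.+1 *: s n) v.
  by rewrite repB repZ (sphi n phi Jphi) scaler0 subr0.
have : opnorm (phi a) <= rnorm (a - h n.+1 *: s n).
  apply: opnorm_le; first exact: rnorm_ge0.
  by move=> v; rewrite phiE; exact: rep_rnorm_le.
rewrite -lecR -aphi -rnormE => /(le_trans a1)/le_trans/(_ aS').
by rewrite lerBrDr gerDl lt_geF// half_exp_gt0.
Qed.

Lemma countable_strictly_norming :
  (forall I : Prim A, countable_nbhs_base I) ->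
  forall F : rep_family A, strictly_norming F -> exhausting F.
Proof.
move=> cI F Fs pi irr; apply: contrapT => nF.
pose I := @PrimIdeal _ A (rker pi) (ex_intro2 _ _ pi irr erefl).
have [B [/countable_injP[g ginj] Bn BU]] := cI I.
have /choice[J JP] n : exists J : set A, [/\ closed_ideal J, ~ J `<=` rker pi &
    forall V, B V -> g V = n -> prim_of J `<=` V].
  have [[V [BV gV]]|nV] := pselect (exists V, B V /\ g V = n).
    have := Bn V BV; rewrite nbhsE => -[U [/prim_openE[J Ji ->] JI] UV].
    exists J; split=> // V' BV' gV'.
    suff -> : V' = V by [].
    by apply: ginj; rewrite ?inE// gV gV'.
  (* [n] is the code of no member of [B]; the whole algebra serves as default, since [pi] does not
     kill it. *)
  exists setT; split.
  - by split=> //; exact: closedT.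
  - move=> TI; have [v] := irreducible_cone_neq0 irr.
    by move=> /eqP; apply; exact: TI.
  - by move=> V BV gV; exfalso; apply: nV; exists V.
have [||a aJ] := @ex_norm_drop pi J irr.
- by move=> n; have [] := JP n.
- by move=> n; have [] := JP n.
have [phi Fphi aphi] := Fs a.
have nK : ~ rker phi `<=` rker pi by move=> K; apply: nF; exists phi.
have Ki := rker_closed_ideal (@complex_half_expn R) phi.
have [|V BV VU] := BU (prim_of (rker phi)).
  by apply: open_nbhs_nbhs; split=> //; apply/prim_openE; exists (rker phi).
apply: (aJ (g V) phi _ aphi); apply: contrapT => nJ.
(* ker rho would lie in Prim(J), hence in [V], but not in Prim(ker phi), although [V] is contained
   in the latter. *)
have [rho [rirr phirho Jrho]] := ex_irreducible_sub_ideal nJ.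
pose I' := @PrimIdeal _ A (rker rho) (ex_intro2 _ _ rho rirr erefl).
have [_ _ JV] := JP (g V).
by have := VU I' (JV V BV erefl I' Jrho).
Qed.

End NormDrop.

Theorem proposition4p3 (R : realType) (A : cstarAlgType R[i]) :
  ((forall I : Prim A, countable_nbhs_base I) ->
     forall F : rep_family A, strictly_norming F -> exhausting F) /\
  (accessible_space (Prim A) ->
     (forall F : rep_family A, strictly_norming F -> exhausting F) ->
     forall I : Prim A, countable_nbhs_base I).
Proof.
by split; [exact: countable_strictly_norming|exact: strictly_norming_countable].
Qed.
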